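(* Let $(M,g)$ be a $4$-dimensional hyperbolic FLRW spacetime, $M=(0,\infty)\times\mathbb{R}^3$, $g=-dt^2+a(t)^2\big(dr^2+\sinh^2(r)\,d\Omega_2^2\big)$, with smooth scale factor $a:(0,\infty)\to(0,\infty)$ satisfying $\lim_{t\to0^+}a(t)=0$ and such that $a'(0):=\lim_{t\to0^+}a'(t)$ exists in $[0,\infty]$ and $a'(0)\neq1$. Assume that $(M,g)$ is future $C^0$-inextendible. Let $\psi_s:(t,r,\omega)\mapsto(T(t,r),R(t,r),\omega)$ be the unique (subject to an initial condition and away from the set where its Jacobian determinant vanishes) natural strongly spherical change of coordinates on $\tilde M=M\setminus\big(\{\cosh^2(r)=\sinh^2(r)a'(t)^2\}\cup\{r=0\}\big)$ (as defined in the context), so that $(\psi_s)_*g$ takes the strongly spherically symmetric form. Then there is no natural strongly axisymmetric $C^0$-extension of $(M,g)$ compatible with $\psi_s$.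
   Context: Conventions. A $C^k$ spacetime is a connected time-oriented Lorentzian manifold $(M,g)$ with $M$ smooth and $g$ of regularity $C^k$. Timelike curves are piecewise smooth curves whose one-sided derivatives are timelike and lie in the same connected component of the lightcone. Extensions. A $C^0$-extension of $(M,g)$ is a proper (i.e. $\iota(M)\neq M_{\mathrm{ext}}$) isometric embedding $\iota:(M,g)\hookrightarrow(M_{\mathrm{ext}},g_{\mathrm{ext}})$ into a $C^0$ spacetime of the same dimension; $\partial\iota(M)$ is the topological boundary of $\iota(M)$ in $M_{\mathrm{ext}}$. The future boundary $\partial^+\iota(M)$ is the set of $p\in\partial\iota(M)$ for which there is a future directed timelike curve $\gamma:[0,1]\to M_{\mathrm{ext}}$ with $\gamma(1)=p$, $\gamma([0,1))\subset\iota(M)$. $(M,g)$ is future $C^0$-inextendible if it has no $C^0$-extension with $\partial^+\iota(M)\neq\emptyset$. FLRW coordinates. $(t,r,\omega)\in(0,\infty)\times(0,\infty)\times\mathbb{S}^2$, where $(r,\omega)$ are geodesic polar coordinates on hyperbolic $3$-space about a chosen origin; $d\Omega_2^2$ is the round metric of the unit sphere $\mathbb{S}^2$. Natural strongly spherical change of coordinates. This is a local diffeomorphism on $\tilde M$ of the form $\psi_s:(t,r,\omega)\mapsto(T(t,r),R(t,r),\omega)\in\mathbb{R}\times(0,\infty)\times\mathbb{S}^2$ in which the metric takes the strongly spherically symmetric form $$g_s=(\psi_s)_*g=-F(T,R)\,dT^2+G(T,R)\,dR^2+R^2d\Omega_2^2 .$$ ($R$ is allowed to be the timelike coordinate.)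 It is unique subject to an initial condition; one has $R=a(t)\sinh(r)$ and $G=\frac{1}{\cosh^2(r)-\sinh^2(r)a'(t)^2}$. The excluded set $\{\cosh^2(r)=\sinh^2(r)a'(t)^2\}$ is where the Jacobian determinant of $(t,r)\mapsto(T,R)$ vanishes. Strongly axisymmetric form. With coordinates $(T,z,\rho,\varphi)\in\mathbb{R}\times\mathbb{R}\times(0,\infty)\times\mathbb{S}^1$, a metric has strongly axisymmetric form if it equals $$-A\,dT^2+B\,dz^2+C\,d\rho^2+\rho^2d\varphi^2+(D_1dT+D_2dz+D_3d\rho)\,d\varphi \qquad(\ast)$$ where $d\varphi^2$ is the standard metric on $\mathbb{S}^1$ and the coefficients $A,B,C,D_1,D_2,D_3$ are smooth functions of the coordinates $T,z,\rho$ only (no sign assumption on coefficients, but the signature is Lorentzian). Natural strongly axisymmetric change of coordinates. Given $\psi_s$ and a choice of polar coordinates $(\theta,\varphi)\in(0,\pi)\times\mathbb{S}^1$ on $\mathbb{S}^2$ minus two antipodal points (so $d\Omega_2^2=d\theta^2+\sin^2\theta\,d\varphi^2$), $\psi_a$ denotes a local diffeomorphism of the form $(T,R,\theta,\varphi)\mapsto(T,z(R,\theta),\rho(R,\theta),\varphi)$, with $\rho>0$, defined away from $\{G=-\tan^2\theta\}\cup\{\theta=0,\pi\}$, such that $g_a:=(\psi_a)_*(\psi_s)_*g$ has the form $(\ast)$. Natural strongly axisymmetric $C^0$-extension compatible with $\psi_s$. A $C^0$-extension $\iota:(M,g)\to(M_{\mathrm{ext}},g_{\mathrm{ext}})$ such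 that for every $p\in\partial\iota(M)$: (i) there exist a neighbourhood $V$ of $p$ in $M_{\mathrm{ext}}$ and a (possibly empty) two-dimensional submanifold $S\subset V$ such that $U:=V\setminus S$ satisfies $\iota^{-1}(U)\cap(M\setminus\tilde M)=\emptyset$, and there is a diffeomorphism $\psi_{\mathrm{ext},a}:U\to\psi_{\mathrm{ext},a}(U)\subseteq\mathbb{R}\times\mathbb{R}\times(0,\infty)\times\mathbb{S}^1$ such that $(\psi_{\mathrm{ext},a})_*g_{\mathrm{ext}}$ has the strongly axisymmetric form $(\ast)$ (in particular it is non-degenerate on $\psi_{\mathrm{ext},a}(U)$); (ii) $\psi_a\circ\psi_s|_{\tilde U}=\psi_{\mathrm{ext},a}\circ\iota|_{\tilde U}$, where $\psi_a$ is a natural strongly axisymmetric change of coordinates (for some choice of $(\theta,\varphi)$) and $\tilde U=\iota^{-1}(U)\setminus\big(\{G=-\tan^2\theta\}\cup\{\theta=0,\pi\}\big)$. *)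

(* Defs.v *)
From HB Require Import structures.
From mathcomp Require Import all_boot all_order all_algebra.
From mathcomp Require Import all_classical all_reals all_analysis.
Set Implicit Arguments.
Unset Strict Implicit.
Unset Printing Implicit Defensive.
Import Order.TTheory GRing.Theory Num.Theory.
Import numFieldNormedType.Exports.
Local Open Scope classical_set_scope.
Local Open Scope ring_scope.

(* [U] is meant to be open, so that the derivatives of the total function [f]
   at points of [U] only depend on its restriction to [U]. *)

Fixpoint Ck (R : realType) (V W : normedModType R) (k : nat)
    (U : set V) (f : V -> W) : Prop :=
  match k with
  | 0%N => forall x, U x -> {for x, continuous f}
  | k'.+1 => (forall x, U x -> differentiable f x) /\
             (forall v, Ck k' U (fun x => 'D_v f x))
  end.

Definition smooth_on (R : realType) (V W : normedModType R)
    (U : set V) (f : V -> W) : Prop := forall k, Ck k U f.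

Definition diffeo_on (R : realType) (V W : normedModType R)
    (U : set V) (f : V -> W) : Prop :=
  [/\ open U, open (f @` U), smooth_on U f &
      exists2 f' : W -> V, smooth_on (f @` U) f' & forall x, U x -> f' (f x) = x].

Definition local_diffeo_on (R : realType) (V W : normedModType R)
    (U : set V) (f : V -> W) : Prop :=
  forall x, U x -> exists N : set V, [/\ N x, N `<=` U & diffeo_on N f].

(* Vectors and covectors are rows and the value of [h] on [(v, w)] is
   [v *m h *m w^T].  The differential of [f] at [p] acts as
   [v |-> v *m 'J f p], so the form [h] at [f p] pulls back to
   ['J f p *m h *m ('J f p)^T]. *)

Definition form4 (R : realType) (h : 'M[R]_4) (v w : 'rV[R]_4) : R :=
  (v *m h *m w^T) 0 0.

Definition pull (R : realType) (J h : 'M[R]_4) : 'M[R]_4 := J *m h *m J^T.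

Definition lorentzian (R : realType) (h : 'M[R]_4) : Prop :=
  h^T = h /\ exists2 P : 'M[R]_4, P \in unitmx &
    pull P h = diag_mx (\row_(j < 4) (if j == 0 then -1 else 1)).

Definition dcoord (R : realType) (j : 'I_4) : 'rV[R]_4 := delta_mx 0 j.

(* The symmetric product (eta (x) zeta + zeta (x) eta) / 2. *)
Definition symprod (R : realType) (eta zeta : 'rV[R]_4) : 'M[R]_4 :=
  2^-1 *: (eta^T *m zeta + zeta^T *m eta).

Definition sq (R : realType) (eta : 'rV[R]_4) : 'M[R]_4 := symprod eta eta.

Record chart (R : realType) (T : topologicalType) := Chart {
  chart_dom : set T;
  chart_cod : set 'rV[R]_4;
  to_coord : T -> 'rV[R]_4;
  of_coord : 'rV[R]_4 -> T;
  open_dom : open chart_dom;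
  open_cod : open chart_cod;
  to_coord_cod : forall p, chart_dom p -> chart_cod (to_coord p);
  of_coord_dom : forall x, chart_cod x -> chart_dom (of_coord x);
  to_coordK : forall p, chart_dom p -> of_coord (to_coord p) = p;
  of_coordK : forall x, chart_cod x -> to_coord (of_coord x) = x;
  to_coord_continuous : forall p, chart_dom p -> {for p, continuous to_coord};
  of_coord_continuous : forall x, chart_cod x -> {for x, continuous of_coord}
}.

Definition transition (R : realType) (T : topologicalType) (c c' : chart R T)
  : 'rV[R]_4 -> 'rV[R]_4 := to_coord c' \o of_coord c.

Definition overlap (R : realType) (T : topologicalType) (c c' : chart R T)
  : set 'rV[R]_4 := chart_cod c `&` of_coord c @^-1` chart_dom c'.

Definition compatible (R : realType) (T : topologicalType) (c c' : chart R T)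
  : Prop :=
  smooth_on (overlap c c') (transition c c') /\
  smooth_on (overlap c' c) (transition c' c).

(* A maximal smooth atlas: its members are exactly the diffeomorphisms from
   open subsets of the manifold onto open subsets of R^4. *)
Definition smooth_structure (R : realType) (T : topologicalType)
    (atlas : set (chart R T)) : Prop :=
  [/\ forall p, exists2 c, atlas c & chart_dom c p,
      forall c c', atlas c -> atlas c' -> compatible c c' &
      forall c, (forall c', atlas c' -> compatible c c') -> atlas c].

(* [met c x] is the matrix of the metric at the point [of_coord c x] in the
   chart [c]. *)
Definition C0_metric (R : realType) (T : topologicalType)
    (atlas : set (chart R T)) (met : chart R T -> 'rV[R]_4 -> 'M[R]_4) : Prop :=
  forall c, atlas c ->
  [/\ forall x, chart_cod c x -> {for x, continuous (met c)},
      forall x, chart_cod c x -> lorentzian (met c x) &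
      forall c' x, atlas c' -> overlap c c' x ->
        met c x = pull ('J (transition c c') x) (met c' (transition c c' x))].

(* A time orientation is represented by a continuous timelike vector field,
   given by its components [tor c] in each chart. *)
Definition time_orientation (R : realType) (T : topologicalType)
    (atlas : set (chart R T)) (met : chart R T -> 'rV[R]_4 -> 'M[R]_4)
    (tor : chart R T -> 'rV[R]_4 -> 'rV[R]_4) : Prop :=
  forall c, atlas c ->
  [/\ forall x, chart_cod c x -> {for x, continuous (tor c)},
      forall x, chart_cod c x -> form4 (met c x) (tor c x) (tor c x) < 0 &
      forall c' x, atlas c' -> overlap c c' x ->
        tor c' (transition c c' x) = tor c x *m 'J (transition c c') x].

Record spacetime (R : realType) := Spacetime {
  carrier :> topologicalType;
  atlas : set (chart R carrier);
  metric : chart R carrier -> 'rV[R]_4 -> 'M[R]_4;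
  tor : chart R carrier -> 'rV[R]_4 -> 'rV[R]_4;
  spacetime_hausdorff : hausdorff_space carrier;
  spacetime_second_countable : @second_countable carrier;
  spacetime_connected : connected [set: carrier];
  spacetime_smooth : smooth_structure atlas;
  spacetime_metric : C0_metric atlas metric;
  spacetime_time_orientation : time_orientation atlas metric tor
}.

Definition future_timelike (R : realType) (E : spacetime R)
    (c : chart R E) (x v : 'rV[R]_4) : Prop :=
  form4 (metric c x) v v < 0 /\ form4 (metric c x) v (tor c x) < 0.

(* [gamma] restricted to [s, t] is smooth up to the endpoints (it extends
   smoothly around every point of [s, t], in a chart), with future directed
   timelike velocity; at the endpoints the velocity is one-sided. *)
Definition future_timelike_piece (R : realType) (E : spacetime R)
    (gamma : R -> E) (s t : R) : Prop :=
  forall u, s <= u <= t ->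
  exists c : chart R E, exists h : R -> 'rV[R]_4, exists e : R,
  [/\ atlas c, 0 < e, smooth_on (ball u e) h,
      forall u', s <= u' <= t -> ball u e u' ->
        chart_dom c (gamma u') /\ to_coord c (gamma u') = h u' &
      future_timelike c (h u) ('D_1 h u)].

Definition future_timelike_curve (R : realType) (E : spacetime R)
    (gamma : R -> E) : Prop :=
  exists n : nat, exists s : nat -> R,
  [/\ s 0%N = 0, s n = 1 &
      forall i, (i < n)%N ->
        s i < s i.+1 /\ future_timelike_piece gamma (s i) (s i.+1)].

Definition submanifold2 (R : realType) (E : spacetime R) (S : set E) : Prop :=
  forall q, S q -> exists c : chart R E,
  [/\ atlas c, chart_dom c q &
      forall p, chart_dom c p ->
        (S p <-> to_coord c p 0 2 = 0 /\ to_coord c p 0 3 = 0)].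

(* The extended spacetime is given in one global chart: an open set
   [M] of R^4, a metric [g] and a vector field [X] fixing its time orientation. *)

Definition smooth_embedding (R : realType) (M : set 'rV[R]_4)
    (E : spacetime R) (iota : 'rV[R]_4 -> E) : Prop :=
  [/\ set_inj M iota,
      forall p, M p -> {for p, continuous iota},
      forall W : set 'rV[R]_4, open W -> W `<=` M ->
        exists2 O : set E, open O & iota @` W = O `&` iota @` M,
      forall c : chart R E, atlas c ->
        smooth_on (M `&` iota @^-1` chart_dom c) (to_coord c \o iota) &
      forall (c : chart R E) p, atlas c -> M p -> chart_dom c (iota p) ->
        'J (to_coord c \o iota) p \in unitmx].

(* Extensions preserve the time orientation, as spacetimes are time-oriented. *)
Definition C0_extension (R : realType) (M : set 'rV[R]_4)
    (g : 'rV[R]_4 -> 'M[R]_4) (X : 'rV[R]_4 -> 'rV[R]_4)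
    (E : spacetime R) (iota : 'rV[R]_4 -> E) : Prop :=
  [/\ smooth_embedding M iota,
      forall (c : chart R E) p, atlas c -> M p -> chart_dom c (iota p) ->
        g p = pull ('J (to_coord c \o iota) p) (metric c (to_coord c (iota p))),
      forall (c : chart R E) p, atlas c -> M p -> chart_dom c (iota p) ->
        future_timelike c (to_coord c (iota p))
          (X p *m 'J (to_coord c \o iota) p) &
      iota @` M <> [set: E]].

Definition boundary (T : topologicalType) (A : set T) : set T :=
  closure A `\` A°.

Definition future_boundary (R : realType) (M : set 'rV[R]_4)
    (E : spacetime R) (iota : 'rV[R]_4 -> E) : set E :=
  [set p | boundary (iota @` M) p /\
    exists gamma : R -> E,
    [/\ future_timelike_curve gamma, gamma 1 = p &
        forall s, 0 <= s < 1 -> (iota @` M) (gamma s)]].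

Definition future_C0_inextendible (R : realType) (M : set 'rV[R]_4)
    (g : 'rV[R]_4 -> 'M[R]_4) (X : 'rV[R]_4 -> 'rV[R]_4) : Prop :=
  ~ exists (E : spacetime R) (iota : 'rV[R]_4 -> E),
      C0_extension M g X iota /\ future_boundary M iota !=set0.

(* Points of M = (0, oo) x R^3 are rows (t, x1, x2, x3), where
   (x1, x2, x3) = r omega are geodesic normal coordinates of hyperbolic 3-space.
   In the same way (0, oo) x S^2 is identified with R^3 \ {0} through
   (R, omega) |-> R omega throughout. *)

Definition sinh (R : realType) (x : R) : R := (expR x - expR (- x)) / 2.
Definition cosh (R : realType) (x : R) : R := (expR x + expR (- x)) / 2.

Definition sph_rad (R : realType) (p : 'rV[R]_4) : R :=
  Num.sqrt (\sum_(j < 4 | j != 0) p 0 j ^+ 2).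

Definition drad (R : realType) (p : 'rV[R]_4) : 'rV[R]_4 :=
  \row_(j < 4) (if j == 0 then 0 else p 0 j / sph_rad p).

Definition euclid3 (R : realType) : 'M[R]_4 :=
  \sum_(j < 4 | j != 0) sq (dcoord R j).

(* From dx1^2 + dx2^2 + dx3^2 = dr^2 + r^2 dOmega^2. *)
Definition dOmega2 (R : realType) (p : 'rV[R]_4) : 'M[R]_4 :=
  (sph_rad p ^+ 2)^-1 *: (euclid3 R - sq (drad p)).

Definition spherical_form (R : realType) (al be ga : R) (p : 'rV[R]_4)
  : 'M[R]_4 :=
  al *: sq (dcoord R 0) + be *: sq (drad p) + ga *: dOmega2 p.

Definition flrw_domain (R : realType) : set 'rV[R]_4 := [set p | 0 < p 0 0].

(* At r = 0, where polar coordinates degenerate, the value is the smooth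
   extension. *)
Definition flrw_metric (R : realType) (a : R -> R) (p : 'rV[R]_4) : 'M[R]_4 :=
  if sph_rad p == 0 then - sq (dcoord R 0) + a (p 0 0) ^+ 2 *: euclid3 R
  else spherical_form (-1) (a (p 0 0) ^+ 2)
         (a (p 0 0) ^+ 2 * sinh (sph_rad p) ^+ 2) p.

Definition flrw_future (R : realType) (p : 'rV[R]_4) : 'rV[R]_4 :=
  delta_mx 0 0.

Definition flrw_tilde (R : realType) (a : R -> R) : set 'rV[R]_4 :=
  [set p | [/\ flrw_domain p,
    cosh (sph_rad p) ^+ 2 <> sinh (sph_rad p) ^+ 2 * derive1 a (p 0 0) ^+ 2 &
    sph_rad p <> 0]].

(* (t, r, omega) |-> (T(t,r), R(t,r), omega) *)
Definition psi_s (R : realType) (T Rr : R -> R -> R) (p : 'rV[R]_4)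
  : 'rV[R]_4 :=
  \row_(j < 4) (if j == 0 then T (p 0 0) (sph_rad p)
                else Rr (p 0 0) (sph_rad p) * (p 0 j / sph_rad p)).

(* As psi_s is only locally invertible, the coefficients F(T,R) and G(T,R) are
   recorded through their values F(T(t,r),R(t,r)) and G(T(t,r),R(t,r)), as
   functions of (t,r). *)
Definition natural_spherical_change (R : realType) (a : R -> R)
    (T Rr F G : R -> R -> R) : Prop :=
  [/\ local_diffeo_on (flrw_tilde a) (psi_s T Rr),
      forall p, flrw_tilde a p -> 0 < Rr (p 0 0) (sph_rad p) &
      forall p, flrw_tilde a p ->
        flrw_metric a p =
        pull ('J (psi_s T Rr) p)
          (spherical_form (- F (p 0 0) (sph_rad p)) (G (p 0 0) (sph_rad p))
             (Rr (p 0 0) (sph_rad p) ^+ 2) (psi_s T Rr p))].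

(* R x R x (0, oo) x S^1 is identified with {(T, z, y1, y2) | (y1, y2) <> 0}
   through (y1, y2) = rho (cos phi, sin phi). *)

Definition cyl_rad (R : realType) (y : 'rV[R]_4) : R :=
  Num.sqrt (y 0 2 ^+ 2 + y 0 3 ^+ 2).

Definition cyl_coord (R : realType) (y : 'rV[R]_4) : 'rV[R]_3 :=
  \row_(j < 3) [:: y 0 0; y 0 1; cyl_rad y]`_j.

Definition drho (R : realType) (y : 'rV[R]_4) : 'rV[R]_4 :=
  (cyl_rad y)^-1 *: (y 0 2 *: dcoord R 2 + y 0 3 *: dcoord R 3).

Definition dphi (R : realType) (y : 'rV[R]_4) : 'rV[R]_4 :=
  (cyl_rad y ^+ 2)^-1 *: (y 0 2 *: dcoord R 3 - y 0 3 *: dcoord R 2).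

Definition axisymmetric_form (R : realType) (A B C D1 D2 D3 : 'rV[R]_3 -> R)
    (y : 'rV[R]_4) : 'M[R]_4 :=
  let c := cyl_coord y in
  - A c *: sq (dcoord R 0) + B c *: sq (dcoord R 1) + C c *: sq (drho y)
  + cyl_rad y ^+ 2 *: sq (dphi y)
  + symprod (D1 c *: dcoord R 0 + D2 c *: dcoord R 1 + D3 c *: drho y) (dphi y).

Definition strongly_axisymmetric (R : realType) (N : set 'rV[R]_4)
    (h : 'rV[R]_4 -> 'M[R]_4) : Prop :=
  [/\ forall y, N y -> 0 < cyl_rad y,
      forall y, N y -> lorentzian (h y) &
      exists A B C D1 D2 D3 : 'rV[R]_3 -> R,
        let N3 := @cyl_coord R @` N in
        [/\ smooth_on N3 A, smooth_on N3 B & smooth_on N3 C] /\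
        [/\ smooth_on N3 D1, smooth_on N3 D2 & smooth_on N3 D3] /\
        (forall y, N y -> h y = axisymmetric_form A B C D1 D2 D3 y)].

(* A choice of polar coordinates on S^2 is an orthogonal matrix [O]:
   omega *m O = (sin theta cos phi, sin theta sin phi, cos theta). *)
Definition spat (R : realType) (p : 'rV[R]_4) : 'rV[R]_3 :=
  \row_(j < 3) p 0 (lift 0 j).

Definition theta (R : realType) (O : 'M[R]_3) (p : 'rV[R]_4) : R :=
  acos ((spat p *m O) 0 2 / sph_rad p).

(* (T, R, theta, phi) |-> (T, z(R,theta), rho(R,theta), phi) *)
Definition psi_a (R : realType) (O : 'M[R]_3) (z rho : R -> R -> R)
    (q : 'rV[R]_4) : 'rV[R]_4 :=
  let w := spat q *m O in
  let s := Num.sqrt (w 0 0 ^+ 2 + w 0 1 ^+ 2) in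
  \row_(j < 4) [:: q 0 0; z (sph_rad q) (theta O q);
                   rho (sph_rad q) (theta O q) * (w 0 0 / s);
                   rho (sph_rad q) (theta O q) * (w 0 1 / s)]`_j.

(* The set {G = - tan^2 theta} U {theta = 0, pi}, seen in M tilde.  The library
   sets tan (pi / 2) = 0, which is harmless since G never vanishes. *)
Definition axis_excluded (R : realType) (O : 'M[R]_3) (G : R -> R -> R)
  : set 'rV[R]_4 :=
  [set p : 'rV[R]_4 | [\/ G (p 0 0) (sph_rad p) = - tan (theta O p) ^+ 2,
                          theta O p = 0 | theta O p = pi]].

(* psi_a, defined on psi_s(D) with D a subset of M tilde avoiding the excluded
   set.  The push-forward of the metric by the local diffeomorphism psi_a o psi_s
   is understood locally. *)
Definition natural_axisymmetric_change (R : realType) (a : R -> R)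
    (T Rr G : R -> R -> R) (O : 'M[R]_3) (z rho : R -> R -> R)
    (D : set 'rV[R]_4) : Prop :=
  let psi := psi_a O z rho \o psi_s T Rr in
  [/\ O *m O^T = 1%:M,
      D `<=` flrw_tilde a `\` axis_excluded O G,
      local_diffeo_on (psi_s T Rr @` D) (psi_a O z rho),
      forall q, (psi_s T Rr @` D) q -> 0 < rho (sph_rad q) (theta O q) &
      forall p, D p -> exists (N : set 'rV[R]_4) (ga : 'rV[R]_4 -> 'M[R]_4),
        [/\ N p, N `<=` D, diffeo_on N psi,
            strongly_axisymmetric (psi @` N) ga &
            forall q, N q -> flrw_metric a q = pull ('J psi q) (ga (psi q))]].

(* [c] is the diffeomorphism psi_{ext,a}, whose domain is V minus S. *)
Definition natural_axisymmetric_extension (R : realType) (a : R -> R)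
    (T Rr G : R -> R -> R) (E : spacetime R) (iota : 'rV[R]_4 -> E) : Prop :=
  C0_extension (@flrw_domain R) (flrw_metric a) (@flrw_future R) iota /\
  forall p, boundary (iota @` @flrw_domain R) p ->
  exists (V S : set E) (c : chart R E),
  [/\ open_nbhs p V /\ S `<=` V, submanifold2 S,
      (forall q, flrw_domain q -> (V `\` S) (iota q) -> flrw_tilde a q),
      [/\ atlas c, chart_dom c = V `\` S & strongly_axisymmetric (chart_cod c) (metric c)] &
      exists (O : 'M[R]_3) (z rho : R -> R -> R),
        let Ut := @flrw_domain R `&` iota @^-1` (V `\` S)
                  `\` axis_excluded O G in
        natural_axisymmetric_change a T Rr G O z rho Ut /\
        forall q, Ut q -> psi_a O z rho (psi_s T Rr q) = to_coord c (iota q)].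

(* Main.v *)
Require Import Defs.
From HB Require Import structures.
From mathcomp Require Import all_boot all_order all_algebra.
From mathcomp Require Import all_classical all_reals all_analysis.
From mathcomp Require Import ring lra.
Set Implicit Arguments.
Unset Strict Implicit.
Unset Printing Implicit Defensive.
Import Order.TTheory GRing.Theory Num.Theory.
Import numFieldNormedType.Exports.
Local Open Scope classical_set_scope.
Local Open Scope ring_scope.

(** The metric in spherical coordinates has G^-1 = 1 + R^2 K(t), where
    K = (1 - a'^2) / a^2.  Orbits of the axial rotation force rho = R sin theta;
    comparing the values of the metric on radial and polar vectors then gives
    G z_theta cos theta = - R sin theta z_R, and as z only depends on (R, theta),
    so does G.  Hence G is locally independent of t at fixed R, and K is locally
    constant wherever the axisymmetric coordinates exist.

    The image of M is open by the inverse function theorem.  As there is no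
    future boundary, a timelike segment issuing to the future of a boundary point
    lies in the image.  Along its preimage t increases, and t tends to 0 at the
    boundary point: otherwise the preimage would converge in M.  So every
    neighbourhood of a boundary point contains points of M at all small times,
    the excluded points are nowhere dense, and K is constant on some (0, t1).
    Then a'^2 = 1 - K a^2 tends to 1, which contradicts a'(0) <> 1. *)

(** * Quadratic forms in spherical and axisymmetric form *)

(** The extended metric is only continuous, so neither geodesics nor curvature are available in [E].
    The causal argument uses straight coordinate segments in a single chart, whose timelike
    character survives small perturbations because it is an open condition; curvature enters only
    through the smooth function K on M.

    In Cartesian coordinates, angular derivatives become derivatives along explicit rotation curves,
    which [psi_s] and, for rotations about the axis, [psi_a] send to rotation curves again. In this
    way [T], [Rr], [z] and [rho] are never differentiated on their own, only as parts of [psi_s] and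
    [psi_a].

    Local constancy of K near a dense set of times does not by itself make K constant, as a devil's
    staircase shows. What helps is that K' is continuous: it vanishes on a dense set, hence
    everywhere.

    The preimage of a segment cannot escape to spatial infinity while t stays away from 0: there [a]
    has a positive lower bound, which bounds the displacement in space by the elapsed coordinate
    time. *)

Section BilinearForms.
Context {R : realType}.
Implicit Types (p q v w y : 'rV[R]_4) (h : 'M[R]_4).

Lemma sum_ord4 (V : nmodType) (F : 'I_4 -> V) : \sum_(j < 4) F j = F 0 + F 1 + F 2 + F 3.
Proof.
rewrite 4!big_ord_recl big_ord0 addr0 !addrA.
by congr (F _ + F _ + F _ + F _); apply/val_inj.
Qed.

Lemma sum_ord3 (V : nmodType) (F : 'I_3 -> V) : \sum_(j < 3) F j = F 0 + F 1 + F 2.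
Proof.
rewrite 3!big_ord_recl big_ord0 addr0 !addrA.
by congr (F _ + F _ + F _); apply/val_inj.
Qed.

Definition dot3 p v : R := p 0 1 * v 0 1 + p 0 2 * v 0 2 + p 0 3 * v 0 3.

Lemma sum_spatial (V : nmodType) (F : 'I_4 -> V) :
  \sum_(j < 4 | j != 0) F j = F 1 + F 2 + F 3.
Proof. by rewrite big_mkcond sum_ord4 /= add0r. Qed.

Lemma sph_rad_sqr p : sph_rad p ^+ 2 = dot3 p p.
Proof.
rewrite /sph_rad sum_spatial sqr_sqrtr ?/dot3 -?expr2 //.
by rewrite !addr_ge0 ?sqr_ge0.
Qed.

Lemma sph_rad_ge0 p : 0 <= sph_rad p. Proof. exact: sqrtr_ge0. Qed.

Lemma form4D h1 h2 v w : form4 (h1 + h2) v w = form4 h1 v w + form4 h2 v w.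
Proof. by rewrite /form4 mulmxDr mulmxDl mxE. Qed.

Lemma form4B h1 h2 v w : form4 (h1 - h2) v w = form4 h1 v w - form4 h2 v w.
Proof. by rewrite /form4 mulmxBr mulmxBl mxE [X in _ + X]mxE. Qed.

Lemma form4Z k h v w : form4 (k *: h) v w = k * form4 h v w.
Proof. by rewrite /form4 -scalemxAr -scalemxAl mxE. Qed.

Lemma form4N h v w : form4 (- h) v w = - form4 h v w.
Proof. by rewrite -scaleN1r form4Z mulN1r. Qed.

Definition pairing v (eta : 'rV[R]_4) : R := (v *m eta^T) 0 0.

Lemma pairingD v eta zeta : pairing v (eta + zeta) = pairing v eta + pairing v zeta.
Proof. by rewrite /pairing linearD mulmxDr mxE. Qed.

Lemma pairingZ v k eta : pairing v (k *: eta) = k * pairing v eta.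
Proof. by rewrite /pairing linearZ -scalemxAr mxE. Qed.

Lemma form4_symprod eta zeta v w : form4 (symprod eta zeta) v w =
  2^-1 * (pairing v eta * pairing w zeta
        + pairing v zeta * pairing w eta).
Proof.
rewrite /symprod form4Z form4D /pairing; congr (_ * _).
have E (x z : 'rV[R]_4) :
  form4 (x^T *m z) v w = (v *m x^T) 0 0 * (w *m z^T) 0 0.
  rewrite /form4 mulmxA -mulmxA mxE big_ord1; congr (_ * _).
  by rewrite -[z in LHS]trmxK -trmx_mul mxE.
by rewrite !E.
Qed.

Lemma form4_sq eta v w :
  form4 (sq eta) v w = pairing v eta * pairing w eta.
Proof. by rewrite /sq form4_symprod; field. Qed.

Lemma dcoordE j v : pairing v (dcoord R j) = v 0 j.
Proof.
rewrite /pairing mxE (bigD1 j) //= !mxE !eqxx /= mulr1 big1 ?addr0 // => i ij.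
by rewrite !mxE eqxx (negPf ij) mulr0.
Qed.

Lemma form4_euclid3 v w : form4 (euclid3 R) v w = dot3 v w.
Proof.
by rewrite /euclid3 sum_spatial !form4D /= !form4_sq !dcoordE.
Qed.

Lemma dradE p v : pairing v (drad p) = dot3 p v / sph_rad p.
Proof. by rewrite /pairing mxE sum_ord4 !mxE /= mulr0 add0r /dot3; ring. Qed.

Lemma form4_spherical al be ga q v w : form4 (spherical_form al be ga q) v w =
  al * (v 0 0 * w 0 0) + be * (dot3 q v * dot3 q w / dot3 q q)
  + ga * ((dot3 v w - dot3 q v * dot3 q w / dot3 q q) / dot3 q q).
Proof.
rewrite /spherical_form /dOmega2 !form4D (form4Z al) (form4Z be) (form4Z ga).
rewrite (form4Z (sph_rad q ^+ 2)^-1) form4B form4_euclid3.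
rewrite !form4_sq !dcoordE !dradE sph_rad_sqr.
have -> : dot3 q v / sph_rad q * (dot3 q w / sph_rad q)
  = dot3 q v * dot3 q w / dot3 q q.
  by rewrite -sph_rad_sqr expr2 invfM; ring.
by congr (_ + _ + _ * _); rewrite mulrC.
Qed.

Lemma form4_pull J h v w : form4 (pull J h) v w = form4 h (v *m J) (w *m J).
Proof. by rewrite /form4 /pull trmx_mul !mulmxA. Qed.

Lemma cyl_rad_sqr y : cyl_rad y ^+ 2 = y 0 2 ^+ 2 + y 0 3 ^+ 2.
Proof. by rewrite sqr_sqrtr // addr_ge0 ?sqr_ge0. Qed.

Lemma drhoE y v :
  pairing v (drho y) = (y 0 2 * v 0 2 + y 0 3 * v 0 3) / cyl_rad y.
Proof.
rewrite /pairing mxE sum_ord4 /drho !mxE /=.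
ring.
Qed.

Lemma dphiE y v :
  pairing v (dphi y) = (y 0 2 * v 0 3 - y 0 3 * v 0 2) / cyl_rad y ^+ 2.
Proof. by rewrite /pairing mxE sum_ord4 /dphi !mxE /=; ring. Qed.

Lemma dot3C v w : dot3 v w = dot3 w v.
Proof. by rewrite /dot3; ring. Qed.

Lemma dot3Dr u v w : dot3 u (v + w) = dot3 u v + dot3 u w.
Proof. by rewrite /dot3 !mxE; ring. Qed.

Lemma dot3Zr k v w : dot3 v (k *: w) = k * dot3 v w.
Proof. by rewrite /dot3 !mxE; ring. Qed.

Lemma dot3Dl u v w : dot3 (v + w) u = dot3 v u + dot3 w u.
Proof. by rewrite /dot3 !mxE; ring. Qed.

Lemma dot3Zl k v w : dot3 (k *: v) w = k * dot3 v w.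
Proof. by rewrite /dot3 !mxE; ring. Qed.

(* The [dphi]-cross terms drop out because both vectors are orthogonal to the
   rotation field. *)
Lemma form4_axisymmetric (A B C D1 D2 D3 : 'rV[R]_3 -> R) y v w :
  pairing v (dphi y) = 0 -> pairing w (dphi y) = 0 ->
  v 0 0 = 0 -> w 0 0 = 0 ->
  form4 (axisymmetric_form A B C D1 D2 D3 y) v w =
  B (cyl_coord y) * (v 0 1 * w 0 1)
  + C (cyl_coord y) * (pairing v (drho y) * pairing w (drho y)).
Proof.
move=> v3 w3 v0 w0.
rewrite /axisymmetric_form !form4D (form4Z (- _)) (form4Z (B _)) (form4Z (C _)).
rewrite (form4Z (cyl_rad y ^+ 2)) form4_symprod !form4_sq !dcoordE.
by rewrite v3 w3 v0 w0 !mulr0 !mul0r; ring.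
Qed.

(** Multiples of the rotation field pair to zero with [dT], [dz] and [drho], so every mixed term
    drops out and the [rho^2 dphi^2] term alone survives, whatever the coefficients are. *)
Lemma form4_axisymmetric_rot (A B C D1 D2 D3 : 'rV[R]_3 -> R) y v :
  v 0 0 = 0 -> v 0 1 = 0 -> pairing v (drho y) = 0 ->
  form4 (axisymmetric_form A B C D1 D2 D3 y) v v =
  cyl_rad y ^+ 2 * pairing v (dphi y) ^+ 2.
Proof.
move=> v0 v1 v2.
rewrite /axisymmetric_form !form4D (form4Z (- _)) (form4Z (B _)) (form4Z (C _)).
rewrite (form4Z (cyl_rad y ^+ 2)) form4_symprod !form4_sq !dcoordE.
have -> : pairing v (D1 (cyl_coord y) *: dcoord R 0
    + D2 (cyl_coord y) *: dcoord R 1 + D3 (cyl_coord y) *: drho y) = 0.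
  rewrite 2!pairingD (pairingZ _ (D1 _)) (pairingZ _ (D2 _)) (pairingZ _ (D3 _)).
  by rewrite !dcoordE v0 v1 v2; ring.
by rewrite v0 v1 v2 !mulr0 !mul0r expr2; ring.
Qed.

End BilinearForms.

(** * Derivatives along curves *)

Section Calculus.
Context {R : realType}.

Lemma is_derive_row (V : normedModType R) n (f : V -> 'rV[R]_n) t v
    (df : 'rV[R]_n) :
  (forall j, is_derive t v (fun x => f x 0 j) (df 0 j)) -> is_derive t v f df.
Proof.
move=> fj.
have fd : derivable f t v.
  by apply/derivable_mxP => i j; rewrite ord1; have [] := fj j.
apply: DeriveDef => //; rewrite derive_mx //.
by apply/matrixP => i j; rewrite ord1 !mxE; have [] := fj j.
Qed.

Lemma derive_coord (V : normedModType R) n (f : V -> 'rV[R]_n) t v j :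
  derivable f t v -> 'D_v (fun x => f x 0 j) t = ('D_v f t) 0 j.
Proof. by move=> fd; rewrite derive_mx // mxE. Qed.

Lemma is_derive_curve (V W : normedModType R) (f : V -> W) (c : R -> V) t v :
  differentiable f (c t) -> is_derive t 1 c v ->
  is_derive t 1 (f \o c) ('D_v f (c t)).
Proof.
move=> fd [cd cv].
have cdiff : differentiable c t by apply/derivable1_diffP.
have fcd : differentiable (f \o c) t by exact: differentiable_comp.
apply: DeriveDef; first by apply/derivable1_diffP.
rewrite deriveE // diff_comp //= [RHS]deriveE //; congr ('d f (c t) _).
by rewrite -deriveE.
Qed.

Lemma is_derive_line (V : normedModType R) (x v : V) (t : R) :
  is_derive t 1 (fun h : R => x + h *: v) v.
Proof.
have E : is_derive t (1:R) (fun h : R => cst x h + h *: v) (0 + v).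
  apply: is_deriveD.
  have d : differentiable ( *:%R^~ v : R -> V) t.
    by have [] := is_diff_scalel t v.
  apply: DeriveDef; first exact/derivable1_diffP.
  by rewrite deriveE // diff_val scale1r.
by rewrite add0r in E.
Qed.

Lemma is_derive_shifted (g : R -> R) (k x : R) : derivable g x 1 ->
  is_derive (0 : R) 1 (fun h : R => k * g (x + h)) (k * 'D_1 g x).
Proof.
move=> /derivable1_diffP gd.
have gd' : differentiable g (x + (0 : R) *: (1 : R)) by rewrite scale0r addr0.
have H := is_deriveZ k (is_derive_curve (c := fun h : R => x + h *: (1 : R))
  (t := 0) gd' (is_derive_line x (1 : R) 0)).
rewrite scale0r addr0 in H.
have -> // : (fun h : R => k * g (x + h)) =
  k \*: (g \o (fun h : R => x + h *: (1 : R))).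
by apply/funext => h /=; rewrite /GRing.scale /= mulr1.
Qed.

Lemma derive_coord_line (V : normedModType R) n (f : V -> 'rV[R]_n) p v j :
  differentiable f p ->
  is_derive (0 : R) 1 (fun h => f (p + h *: v) 0 j) (('D_v f p) 0 j).
Proof.
move=> fd; have fd' : differentiable f (p + (0 : R) *: v).
  by rewrite scale0r addr0.
have [cd cv] := is_derive_curve fd' (is_derive_line p v 0).
apply: DeriveDef; first by move/derivable_mxP : cd => /(_ 0 j).
have := derive_coord j cd; rewrite cv scale0r addr0 => <-.
by [].
Qed.

Lemma derive_affine (V W : normedModType R) (f : V -> W) x v w :
  differentiable f x -> (forall h : R, f (x + h *: v) = f x + h *: w) ->
  'D_v f x = w.
Proof.
move=> fd fE; have fd' : differentiable f (x + (0 : R) *: v).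
  by rewrite scale0r addr0.
have [_ e1] := is_derive_curve fd' (is_derive_line x v 0).
have [_ e2] := is_derive_line (f x) w 0.
rewrite scale0r addr0 in e1; apply: etrans (etrans (esym e1) _) e2.
by congr (derive _ _ _); apply/funext => h; exact: fE.
Qed.

Lemma near_line (V : normedModType R) (p v : V) (P : set V) :
  nbhs p P -> \forall h \near (0 : R), P (p + h *: v).
Proof.
move=> Pp; have [cd _] := is_derive_line p v 0.
have /derivable1_diffP/differentiable_continuous := cd.
by move=> /(_ P); apply; rewrite scale0r addr0.
Qed.

Lemma smooth_differentiable (V W : normedModType R) (U : set V) (f : V -> W) x :
  smooth_on U f -> U x -> differentiable f x.
Proof. by move=> /(_ 1%N)[fd _]; exact: fd. Qed.

Lemma local_diffeo_differentiable (V W : normedModType R) (U : set V)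
    (f : V -> W) x : local_diffeo_on U f -> U x -> differentiable f x.
Proof.
move=> fU Ux; have [N [Nx _ [_ _ fN _]]] := fU x Ux.
exact: smooth_differentiable fN Nx.
Qed.

Lemma local_diffeo_nbhs (V W : normedModType R) (U : set V)
    (f : V -> W) x : local_diffeo_on U f -> U x -> nbhs x U.
Proof.
move=> fU Ux; have [N [Nx NU [oN _ _ _]]] := fU x Ux.
by apply: (filterS NU); exact: open_nbhs_nbhs.
Qed.

Lemma derive_comp (V W Z : normedModType R) (f : V -> W) (g : W -> Z) x v :
  differentiable f x -> differentiable g (f x) ->
  'D_v (g \o f) x = 'D_('D_v f x) g (f x).
Proof.
move=> fd gd; have gfd : differentiable (g \o f) x.
  exact: differentiable_comp.
by rewrite (deriveE _ gd) (deriveE _ fd) (deriveE _ gfd) (diff_comp fd gd).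
Qed.

Lemma derive_inverse (V W : normedModType R) (f : V -> W) (f' : W -> V) x v :
  differentiable f x -> differentiable f' (f x) ->
  (\forall y \near x, f' (f y) = y) -> 'D_('D_v f x) f' (f x) = v.
Proof.
move=> fd f'd f'K.
rewrite -(derive_comp v fd f'd).
by rewrite -[RHS](@derive_id R _ x); exact: near_eq_derive.
Qed.

Lemma row_inverse_unit n (A B : 'M[R]_n) :
  (forall v : 'rV_n, v *m A *m B = v) -> A \in unitmx.
Proof.
move=> E; have : A *m B = 1%:M.
  by apply/row_matrixP => i; rewrite !rowE mulmx1 mulmxA E.
by move=> /mulmx1_unit[].
Qed.

Lemma local_diffeo_jacobian_unit n (U : set 'rV[R]_n)
    (f : 'rV[R]_n -> 'rV[R]_n) x :
  local_diffeo_on U f -> U x -> 'J f x \in unitmx.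
Proof.
move=> fU Ux; have [N [Nx NU [oN _ fN [f' f'N f'K]]]] := fU x Ux.
have fd := smooth_differentiable fN Nx.
have f'd : differentiable f' (f x).
  by apply: smooth_differentiable f'N _; exists x.
apply: (@row_inverse_unit _ _ ('J f' (f x))) => v.
have Nf : \forall y \near x, f' (f y) = y.
  by near=> y; apply: f'K; near: y; exact: open_nbhs_nbhs.
have e := derive_inverse v fd f'd Nf.
rewrite (deriveEjacobian ('D_v f x) f'd) in e.
by rewrite (deriveEjacobian v fd) in e.
Unshelve. all: by end_near. Qed.

End Calculus.

Lemma near0_gt (R : realType) (x : R) : 0 < x -> \forall h \near (0 : R), 0 < x + h.
Proof.
move=> x0; near=> h; rewrite -ltrBlDl sub0r.
by near: h; apply: lt_nbhsr; rewrite oppr_lt0.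
Unshelve. all: by end_near. Qed.

(** * The spherical change of coordinates *)

Section SphericalChange.
Context {R : realType} (a : R -> R) (T Rr F G : R -> R -> R).
Hypothesis a_gt0 : forall t, 0 < t -> 0 < a t.
Hypothesis a_smooth : smooth_on [set t : R | 0 < t] a.
Hypothesis psi_nat : natural_spherical_change a T Rr F G.

Local Notation r := (@sph_rad R).
Implicit Types p q u v w : 'rV[R]_4.

Lemma flrw_tilde_sph_rad_gt0 p : flrw_tilde a p -> 0 < r p.
Proof. by move=> [_ _ /eqP rp]; rewrite lt_neqAle eq_sym rp sph_rad_ge0. Qed.

Lemma form4_flrw p v w : r p != 0 ->
  form4 (flrw_metric a p) v w = - (v 0 0 * w 0 0)
  + a (p 0 0) ^+ 2 * (dot3 p v * dot3 p w / dot3 p p)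
  + a (p 0 0) ^+ 2 * sinh (r p) ^+ 2 *
    ((dot3 v w - dot3 p v * dot3 p w / dot3 p p) / dot3 p p).
Proof. by move=> rp; rewrite /flrw_metric ifN // form4_spherical mulN1r. Qed.

Lemma form4_psi_s p v w : flrw_tilde a p ->
  form4 (flrw_metric a p) v w =
  form4 (spherical_form (- F (p 0 0) (r p)) (G (p 0 0) (r p))
             (Rr (p 0 0) (r p) ^+ 2) (psi_s T Rr p))
    ('D_v (psi_s T Rr) p) ('D_w (psi_s T Rr) p).
Proof.
have [psd _ E] := psi_nat.
move=> Mp; rewrite (E _ Mp) form4_pull.
by rewrite !deriveEjacobian //; exact: local_diffeo_differentiable Mp.
Qed.

(* Rotation of [p] by the angle [s] in the plane spanned by [u] and [v], where
   [u] is the projection of [p] to that plane. *)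
Definition rotation_curve p u v (s : R) : 'rV[R]_4 :=
  p + ((cos s - 1) *: u + sin s *: v).

Lemma rotation_curve0 p u v : rotation_curve p u v 0 = p.
Proof. by rewrite /rotation_curve cos0 sin0 subrr !scale0r !addr0. Qed.

Lemma is_derive_rotation_curve p u v :
  is_derive (0 : R) 1 (rotation_curve p u v) v.
Proof.
apply: is_derive_row => j.
have -> : (fun s => rotation_curve p u v s 0 j) =
    cst (p 0 j) + (u 0 j *: (cos - cst 1) + v 0 j *: sin).
  by apply/funext => s; rewrite /rotation_curve !mxE !fctE /GRing.scale /=; ring.
have H := (is_deriveD (is_derive_cst (p 0 j) (0 : R) 1)
  (is_deriveD
    (is_deriveZ (u 0 j) (is_deriveB (is_derive_cos 0) (is_derive_cst (1 : R) (0 : R) 1)))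
    (is_deriveZ (v 0 j) (is_derive_sin 0)))).
apply: (is_derive_eq H).
by rewrite sin0 cos0 /GRing.scale /=; ring.
Qed.

Lemma sph_rad_rotation_curve p u v s :
  dot3 u u = dot3 v v -> dot3 u v = 0 -> dot3 p u = dot3 u u -> dot3 p v = 0 ->
  r (rotation_curve p u v s) = r p.
Proof.
move=> uu uv pu pv.
apply/eqP; rewrite -(@eqrXn2 _ 2) ?sph_rad_ge0 // !sph_rad_sqr.
rewrite /rotation_curve !(dot3Dl, dot3Dr) !(dot3Zl, dot3Zr).
rewrite (dot3C u p) (dot3C v p) (dot3C v u) pu pv -uu uv.
have := cos2Dsin2 s; set c := cos s; set d := sin s => cd.
apply/eqP; have -> : d * (d * dot3 u u) = (1 - c ^+ 2) * dot3 u u.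
  by rewrite -cd; ring.
ring.
Qed.

Lemma rotation_plane_exists p : r p != 0 -> exists u v,
  [/\ u 0 0 = 0, v 0 0 = 0 & dot3 v v != 0] /\
  [/\ dot3 u u = dot3 v v, dot3 u v = 0, dot3 p u = dot3 u u & dot3 p v = 0].
Proof.
move=> rp; have {}rp : dot3 p p != 0 by rewrite -sph_rad_sqr expf_eq0.
pose mk x y z : 'rV[R]_4 := \row_(j < 4) [:: 0; x; y; z]`_j.
(* A rotation in the plane of the coordinates 1 and 2 fixes points on the third axis; for these the
   plane of the coordinates 3 and 1 is taken. *)
have [p12|p12] := eqVneq (p 0 1 ^+ 2 + p 0 2 ^+ 2) 0.
  have p1 : p 0 1 = 0 by nra.
  have p2 : p 0 2 = 0 by nra.
  exists (mk 0 0 (p 0 3)), (mk (p 0 3) 0 0).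
  move: rp; rewrite /dot3 !mxE /= p1 p2 => rp.
  by split; split; rewrite ?mxE //= ?(mul0r, mulr0, addr0, add0r) // in rp *.
exists (mk (p 0 1) (p 0 2) 0), (mk (- p 0 2) (p 0 1) 0).
rewrite /dot3 !mxE /=; split; split => //; try ring.
by apply: contra p12 => /eqP e; apply/eqP; rewrite -e; ring.
Qed.

Lemma sinh_gt0 (x : R) : 0 < x -> 0 < sinh x.
Proof.
by move=> x0; rewrite /sinh divr_gt0 // subr_gt0 ltr_expR; lra.
Qed.

Lemma dot3_psi_s p v : dot3 (psi_s T Rr p) v = Rr (p 0 0) (r p) / r p * dot3 p v.
Proof. by rewrite /dot3 /psi_s !mxE /=; ring. Qed.

(** As [T] and [Rr] only depend on (t, r), [psi_s] commutes with rotations and maps the circle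
    through [p] to a circle scaled by R / r. *)
Lemma derive_psi_s_rotation p u v : flrw_tilde a p ->
  u 0 0 = 0 -> v 0 0 = 0 -> dot3 u u = dot3 v v -> dot3 u v = 0 ->
  dot3 p u = dot3 u u -> dot3 p v = 0 ->
  'D_v (psi_s T Rr) p = (Rr (p 0 0) (r p) / r p) *: v.
Proof.
move=> Mp u0 v0 uu uv pu pv; have [psd _ _] := psi_nat.
set k := Rr _ _ / _.
have E : psi_s T Rr \o rotation_curve p u v =
    rotation_curve (psi_s T Rr p) (k *: u) (k *: v).
  apply/funext => s; apply/rowP => j /=; rewrite /psi_s mxE.
  rewrite sph_rad_rotation_curve // /rotation_curve !mxE u0 v0 !mulr0 !addr0.
  case: (eqVneq j 0) => [->|_]; first by rewrite u0 v0 !mulr0 !addr0.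
  by rewrite /k; ring.
have d1 : is_derive (0 : R) 1 (psi_s T Rr \o rotation_curve p u v)
    ('D_v (psi_s T Rr) (rotation_curve p u v 0)).
  apply: is_derive_curve (is_derive_rotation_curve p u v).
  by rewrite rotation_curve0; exact: local_diffeo_differentiable Mp.
rewrite rotation_curve0 E in d1.
have [_ e1] := d1.
have [_ e2] := is_derive_rotation_curve (psi_s T Rr p) (k *: u) (k *: v).
exact: etrans (esym e1) e2.
Qed.

(** A vector tangent to the sphere of symmetry has the same length before and after the change of
    coordinates; this compares a^2 sinh^2(r) with R^2, and both roots are positive. *)
Lemma area_radius p : flrw_tilde a p ->
  Rr (p 0 0) (r p) = a (p 0 0) * sinh (r p).
Proof.
move=> Mp; have rp := flrw_tilde_sph_rad_gt0 Mp.
have [_ Rr_gt0 _] := psi_nat; have R0 := Rr_gt0 _ Mp.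
have [u [v [[u0 v0 vv] [uu uv pu pv]]]] := rotation_plane_exists (lt0r_neq0 rp).
have := form4_psi_s v v Mp.
rewrite (derive_psi_s_rotation Mp u0 v0 uu uv pu pv).
rewrite (form4_flrw _ _ (lt0r_neq0 rp)) form4_spherical.
rewrite !(dot3Zr, dot3Zl) !dot3_psi_s (dot3C p (psi_s T Rr p)) dot3_psi_s.
rewrite !mxE v0 pv -sph_rad_sqr.
set A := a _ ; set S := sinh _; set k := Rr _ _ in R0 *; set ro := r p in rp *.
rewrite !(mul0r, mulr0, subr0, add0r, addr0, oppr0) => e.
have [A0 S0] : 0 < A /\ 0 < S.
  by split; [apply: a_gt0; have [] := Mp | exact: sinh_gt0].
have e2 : (A * S) ^+ 2 = k ^+ 2.
  have /eqP : A ^+ 2 * S ^+ 2 * (dot3 v v / ro ^+ 2) = k ^+ 2 * (dot3 v v / ro ^+ 2).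
    rewrite e; field.
    by rewrite !lt0r_neq0.
  rewrite -exprMn => /eqP /mulIf; apply.
  by rewrite mulf_neq0 // invr_eq0 expf_neq0 // lt0r_neq0.
apply/esym/eqP; rewrite -(@eqrXn2 _ 2) //; first exact/eqP.
- by rewrite ltW // mulr_gt0.
- exact: ltW.
Qed.

Lemma is_derive_sinh (x : R) : is_derive x 1 (@sinh R) (cosh x).
Proof.
have -> : @sinh R = 2^-1 \*: (expR - (fun y => (expR y)^-1)).
  by apply/funext => y; rewrite /sinh !fctE /GRing.scale /= expRN mulrC.
have e0 : expR x != 0 by rewrite lt0r_neq0 // expR_gt0.
have ed : derivable (@expR R) x 1 by exact: ex_derive.
have dV : is_derive x (1 : R) (fun y => (expR y)^-1) (- expR x ^- 2 *: expR x).
  apply: DeriveDef; first exact: derivableV.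
  have [_ e1] := is_derive_expR x.
  by rewrite deriveV // [X in _ *: X]e1.
apply: is_derive_eq (is_deriveZ 2^-1 (is_deriveB (is_derive_expR x) dV)) _.
by rewrite /cosh /GRing.scale /= expRN; field; rewrite e0.
Qed.

Lemma a_derivable t : 0 < t -> derivable a t 1.
Proof.
by move=> t0; apply/derivable1_diffP; exact: smooth_differentiable a_smooth t0.
Qed.

(** Only the spatial components are explicit, through [area_radius]; the derivative of [T] stays
    unknown. *)
Lemma derive_psi_s_time p (j : 'I_4) : flrw_tilde a p -> j != 0 ->
  ('D_(delta_mx 0 0) (psi_s T Rr) p) 0 j =
  derive1 a (p 0 0) * sinh (r p) * (p 0 j / r p).
Proof.
move=> Mp j0; have [psd _ _] := psi_nat.
have [_ <-] := derive_coord_line (delta_mx 0 0) j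
  (local_diffeo_differentiable psd Mp).
have t0 : 0 < p 0 0 by have [] := Mp.
have [_ ea] := is_derive_shifted (sinh (r p) * (p 0 j / r p)) (a_derivable t0).
rewrite derive1E -[RHS](mulrA) -[RHS]mulrC; apply: etrans ea.
apply: near_eq_derive.
have := near_line (delta_mx 0 0) (local_diffeo_nbhs psd Mp).
apply: filterS => h Mh.
have rh : r (p + h *: delta_mx 0 0) = r p.
  apply/eqP; rewrite -(@eqrXn2 _ 2) ?sph_rad_ge0 // !sph_rad_sqr /dot3 !mxE /=.
  by rewrite !mulr0 !addr0.
rewrite /psi_s mxE (negPf j0) (area_radius Mh) rh !mxE /= (negPf j0).
by rewrite mulr0 addr0 mulr1; ring.
Qed.

Lemma dot3_drad p v : dot3 (drad p) v = dot3 p v / r p.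
Proof. by rewrite /dot3 !mxE /=; ring. Qed.

Lemma sph_rad_radial p h : 0 < r p -> 0 < r p + h ->
  r (p + h *: drad p) = r p + h.
Proof.
move=> rp rh; apply/eqP; rewrite -(@eqrXn2 _ 2) ?sph_rad_ge0 ?ltW // sph_rad_sqr.
rewrite !(dot3Dl, dot3Dr) !(dot3Zl, dot3Zr) (dot3C p (drad p)) !dot3_drad.
rewrite (dot3C p (drad p)) !dot3_drad -sph_rad_sqr.
by apply/eqP; field; rewrite lt0r_neq0.
Qed.

Lemma derive_psi_s_radial p (j : 'I_4) : flrw_tilde a p -> j != 0 ->
  ('D_(drad p) (psi_s T Rr) p) 0 j = a (p 0 0) * cosh (r p) * (p 0 j / r p).
Proof.
move=> Mp j0; have [psd _ _] := psi_nat.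
have rp := flrw_tilde_sph_rad_gt0 Mp.
have [_ <-] := derive_coord_line (drad p) j (local_diffeo_differentiable psd Mp).
have [sd se] := is_derive_sinh (r p).
have [_ ea] := is_derive_shifted (a (p 0 0) * (p 0 j / r p)) sd.
rewrite -se mulrAC; apply: etrans ea.
apply: near_eq_derive.
have := near_line (drad p) (local_diffeo_nbhs psd Mp).
apply: filterS2 (near0_gt rp) => h hr Mh.
rewrite /psi_s mxE (negPf j0) (area_radius Mh) (sph_rad_radial rp hr) !mxE /=.
rewrite (negPf j0) mulr0 addr0.
by field; rewrite !lt0r_neq0.
Qed.

(** The metric on the plane of [delta_mx 0 0] and [drad p] gives three equations, quadratic in the
    two unknown derivatives of [T]. Passing to determinants eliminates these derivatives together
    with [F]. *)
Lemma spherical_coef_inv p : flrw_tilde a p ->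
  G (p 0 0) (r p) *
  (cosh (r p) ^+ 2 - sinh (r p) ^+ 2 * derive1 a (p 0 0) ^+ 2) = 1.
Proof.
move=> Mp; have rp := flrw_tilde_sph_rad_gt0 Mp.
have Rp := area_radius Mp.
pose v1 : 'rV[R]_4 := delta_mx 0 0; pose v2 := drad p.
set q := psi_s T Rr p; set q1 := 'D_v1 (psi_s T Rr) p.
set q2 := 'D_v2 (psi_s T Rr) p.
set A := a (p 0 0); set A' := derive1 a (p 0 0); set S := sinh (r p).
set C := cosh (r p); set ro := r p.
have A0 : 0 < A by apply: a_gt0; have [] := Mp.
have S0 : 0 < S by exact: sinh_gt0.
have pp : dot3 p p = ro ^+ 2 by rewrite sph_rad_sqr.
have qv v : dot3 q v = A * S / ro * dot3 p v by rewrite dot3_psi_s Rp.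
have q1v v : dot3 q1 v = A' * S / ro * dot3 p v.
  rewrite /dot3 /q1 !(derive_psi_s_time Mp) // -/A' -/S -/ro; ring.
have q2v v : dot3 q2 v = A * C / ro * dot3 p v.
  rewrite /dot3 /q2 !(derive_psi_s_radial Mp) // -/A -/C -/ro; ring.
have v1v v : dot3 v1 v = 0 by rewrite /dot3 /v1 !mxE /=; ring.
have v2v v : dot3 v2 v = dot3 p v / ro by rewrite dot3_drad.
have e u v : _ = _ := etrans (etrans (esym (form4_flrw u v (lt0r_neq0 rp)))
  (form4_psi_s u v Mp)) (form4_spherical _ _ _ q ('D_u (psi_s T Rr) p)
  ('D_v (psi_s T Rr) p)).
have := e v1 v1; have := e v1 v2; have := e v2 v2; rewrite -/q1 -/q2 Rp {e}.
rewrite -/A -/S -/ro.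
have v10 : v1 0 0 = 1 by rewrite /v1 mxE.
have v20 : v2 0 0 = 0 by rewrite /v2 mxE.
clearbody q q1 q2 v1 v2.
rewrite !qv !q1v !q2v.
rewrite (dot3C p q) (dot3C p q1) (dot3C p q2) (dot3C p v1) (dot3C p v2).
rewrite !qv !q1v !q2v !v1v !v2v (dot3C p v2) v2v pp.
rewrite v10 v20.
set x := q1 0 0; set y := q2 0 0; set f := F _ _; set g := G _ _.
have ro0 : ro != 0 by rewrite lt0r_neq0.
have A0' : A != 0 by rewrite lt0r_neq0.
have S0' : S != 0 by rewrite lt0r_neq0.
move=> e22 e12 e11.
have {}e11 : - 1 = - f * (x * x) + g * (A' * S) ^+ 2.
  apply: (etrans _ (etrans e11 _)); first by field.
  by field; rewrite ro0 A0' S0'.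
have {}e12 : 0 = - f * (x * y) + g * (A' * S) * (A * C).
  apply: (etrans _ (etrans e12 _)); first by field.
  by field; rewrite ro0 A0' S0'.
have {}e22 : A ^+ 2 = - f * (y * y) + g * (A * C) ^+ 2.
  apply: (etrans _ (etrans e22 _)); first by field.
  by field; rewrite ro0 A0' S0'.
apply: (mulfI (expf_neq0 2 A0')); rewrite mulr1.
(* both sides are the determinant of the metric on the (t, r)-plane *)
have /(_ _ _ _ e11 e12 e22) D (e1 e2 e3 : R) :
    e1 = - f * (x * x) + g * (A' * S) ^+ 2 ->
    e2 = - f * (x * y) + g * (A' * S) * (A * C) ->
    e3 = - f * (y * y) + g * (A * C) ^+ 2 ->
    g * ((A * C) ^+ 2 * e1 + (A' * S) ^+ 2 * e3 - (A' * S) * (A * C) * e2 *+ 2)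
    = e1 * e3 - e2 ^+ 2.
  by move=> -> -> ->; ring.
apply: oppr_inj; apply: etrans (etrans D _); ring.
Qed.

End SphericalChange.

(** * The axisymmetric change of coordinates *)

Section AxisCoordinates.
Context {R : realType} (O : 'M[R]_3).
Implicit Types p q u v : 'rV[R]_4.

(** In this frame the axis is the last direction: at [psi_s p], the coordinate 2 is R cos theta and
    the coordinates 0 and 1 are R sin theta (cos phi, sin phi). *)
Definition axis_coord u (k : 'I_3) : R := (spat u *m O) 0 k.

Definition axis_vec (x : 'rV[R]_3) : 'rV[R]_4 :=
  \row_j (if unlift 0 j is Some k then (x *m O^T) 0 k else 0).

Lemma spatD u v : spat (u + v) = spat u + spat v.
Proof. by apply/rowP => j; rewrite !mxE. Qed.

Lemma spatZ k u : spat (k *: u) = k *: spat u.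
Proof. by apply/rowP => j; rewrite !mxE. Qed.

Lemma axis_coordD u v k : axis_coord (u + v) k = axis_coord u k + axis_coord v k.
Proof. by rewrite /axis_coord spatD mulmxDl mxE. Qed.

Lemma axis_coordZ c u k : axis_coord (c *: u) k = c * axis_coord u k.
Proof. by rewrite /axis_coord spatZ -scalemxAl mxE. Qed.

Hypothesis O_orth : O *m O^T = 1%:M.

Lemma axis_vec0 x : axis_vec x 0 0 = 0.
Proof. by rewrite mxE unlift_none. Qed.

Lemma axis_coord_vec x k : axis_coord (axis_vec x) k = x 0 k.
Proof.
rewrite /axis_coord; have -> : spat (axis_vec x) = x *m O^T.
  apply/rowP => j; by rewrite /spat /axis_vec !mxE liftK mxE.
by rewrite -mulmxA (mulmx1C O_orth) mulmx1.
Qed.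

Lemma dot3_axis u v : dot3 u v = axis_coord u 0 * axis_coord v 0
  + axis_coord u 1 * axis_coord v 1 + axis_coord u 2 * axis_coord v 2.
Proof.
have E (x y : 'rV[R]_3) :
    (x *m y^T) 0 0 = x 0 0 * y 0 0 + x 0 1 * y 0 1 + x 0 2 * y 0 2.
  by rewrite mxE sum_ord3 !mxE.
rewrite /axis_coord -E trmx_mul mulmxA -(mulmxA (spat u)) O_orth mulmx1 E.
rewrite /dot3 !mxE; congr (_ * _ + _ * _ + _ * _); congr (_ 0 _);
  exact/val_inj.
Qed.

End AxisCoordinates.

Section AxisymmetricChange.
Context {R : realType} (a : R -> R) (T Rr F G : R -> R -> R).
Hypothesis psi_nat : natural_spherical_change a T Rr F G.
Context (O : 'M[R]_3) (z rho : R -> R -> R) (D : set 'rV[R]_4).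
Hypothesis psi_a_nat : natural_axisymmetric_change a T Rr G O z rho D.

Local Notation r := (@sph_rad R).
Local Notation w := (axis_coord O).
Local Notation psis := (psi_s T Rr).
Local Notation psia := (psi_a O z rho).
Implicit Types p q u v : 'rV[R]_4.

Let O_orth : O *m O^T = 1%:M. Proof. by have [] := psi_a_nat. Qed.

Let D_tilde p : D p -> flrw_tilde a p.
Proof. by have [_ H _ _ _] := psi_a_nat; move=> /H []. Qed.

Lemma D_nbhs p : D p -> nbhs p D.
Proof.
have [_ _ _ _ H] := psi_a_nat; move=> /H [N [ga [Np ND [oN _ _ _] _ _]]].
by apply: (filterS ND); exact: open_nbhs_nbhs.
Qed.

Let psia_diff p : D p -> differentiable psia (psis p).
Proof.
by have [_ _ H _ _] := psi_a_nat => Dp; apply: local_diffeo_differentiable H _;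
  exists p.
Qed.

(** The axisymmetric form is given for the pull-back along the composite. The differential of
    [psi_s] at [p] is onto, so the identity can be read on arbitrary vectors at [psi_s p], where the
    metric is spherical and explicit. *)
Lemma psi_a_form p : D p -> 0 < cyl_rad (psia (psis p)) /\
  exists A B C D1 D2 D3 : 'rV[R]_3 -> R, forall u v,
  form4 (spherical_form (- F (p 0 0) (r p)) (G (p 0 0) (r p))
             (Rr (p 0 0) (r p) ^+ 2) (psis p)) u v =
  form4 (axisymmetric_form A B C D1 D2 D3 (psia (psis p)))
    ('D_u psia (psis p)) ('D_v psia (psis p)).
Proof.
move=> Dp; have [_ _ _ _ H] := psi_a_nat.
have [psd _ _] := psi_nat; have Mp := D_tilde Dp.
have [N [ga [Np _ [_ _ sN _] [cyl _ [A [B [C [D1 [D2 [D3 [_ [_ E]]]]]]]]] gp]]] :=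
  H p Dp.
split; first by apply: cyl; exists p.
exists A, B, C, D1, D2, D3 => u v.
have sd := local_diffeo_differentiable psd Mp.
have ad := psia_diff Dp.
have cd := smooth_differentiable sN Np.
have surj x : exists y, 'D_y psis p = x.
  exists (x *m invmx ('J psis p)).
  rewrite (deriveEjacobian _ sd) -mulmxA mulVmx ?mulmx1 //.
  exact: local_diffeo_jacobian_unit psd Mp.
have [u' <-] := surj u; have [v' <-] := surj v.
rewrite -(form4_psi_s psi_nat _ _ Mp) (gp _ Np) form4_pull.
rewrite -(deriveEjacobian u' cd) -(deriveEjacobian v' cd).
rewrite (E _ (ex_intro2 _ _ p Np erefl)).
by rewrite (derive_comp u' sd ad) (derive_comp v' sd ad).
Qed.

Definition axis_dist u : R := Num.sqrt (w u 0 ^+ 2 + w u 1 ^+ 2).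

Lemma axis_dist_sqr u : axis_dist u ^+ 2 = w u 0 ^+ 2 + w u 1 ^+ 2.
Proof. by rewrite sqr_sqrtr // addr_ge0 ?sqr_ge0. Qed.

Lemma psi_aE q : psia q = \row_(j < 4) [:: q 0 0; z (r q) (theta O q);
   rho (r q) (theta O q) * (w q 0 / axis_dist q);
   rho (r q) (theta O q) * (w q 1 / axis_dist q)]`_j.
Proof. by []. Qed.

Lemma axis_dist_gt0 p : D p -> 0 < axis_dist (psis p).
Proof.
move=> Dp; have [c0 _] := psi_a_form Dp.
rewrite lt_neqAle sqrtr_ge0 andbT; apply: contraTneq c0 => s0.
(* If [axis_dist] is 0, so is its inverse by convention; then the coordinates 2 and 3 of [psi_a]
   vanish and so does [cyl_rad]. *)
rewrite -leNgt /cyl_rad psi_aE !mxE /= -s0 invr0 !mulr0 expr0n /= addr0.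
by rewrite sqrtr0.
Qed.

Lemma sph_rad_psi_s p : flrw_tilde a p -> r (psis p) = Rr (p 0 0) (r p).
Proof.
move=> Mp; have [_ R0 _] := psi_nat; have {}R0 := R0 _ Mp.
have rp := flrw_tilde_sph_rad_gt0 Mp.
apply/eqP; rewrite -(@eqrXn2 _ 2) ?sph_rad_ge0 ?ltW // sph_rad_sqr.
rewrite dot3_psi_s dot3C dot3_psi_s -sph_rad_sqr; apply/eqP; field.
by rewrite lt0r_neq0.
Qed.

Definition row3 (x y t : R) : 'rV[R]_3 := \row_j [:: x; y; t]`_j.

(** Rotations about the axis preserve R and theta, so [psi_a] turns them into rotations of the last
    two coordinates. The squared length of the rotation field is R^2 sin^2 theta in the spherical
    form and rho^2 in the axisymmetric one. *)
Lemma rho_axis_dist p : D p ->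
  rho (r (psis p)) (theta O (psis p)) = axis_dist (psis p).
Proof.
move=> Dp; have [c0 [A [B [C [D1 [D2 [D3 E]]]]]]] := psi_a_form Dp.
have s0 := axis_dist_gt0 Dp.
have [_ _ _ rho_gt0 _] := psi_a_nat.
have {rho_gt0} rho0 := rho_gt0 _ (ex_intro2 _ _ p Dp erefl).
have Mp := D_tilde Dp; have ad := psia_diff Dp.
have rq := sph_rad_psi_s Mp.
have R0 : 0 < Rr (p 0 0) (r p) by have [_ H _] := psi_nat; exact: H.
move: (psis p) E c0 s0 rho0 ad rq => q E c0 s0 rho0 ad rq.
pose u := axis_vec O (row3 (w q 0) (w q 1) 0).
pose v := axis_vec O (row3 (- w q 1) (w q 0) 0).
have [uu uv qu qv] : [/\ dot3 u u = dot3 v v, dot3 u v = 0,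
    dot3 q u = dot3 u u & dot3 q v = 0].
  by rewrite !(dot3_axis O_orth) !axis_coord_vec // !mxE /=; split; ring.
have u0 : u 0 0 = 0 by exact: axis_vec0.
have v0 : v 0 0 = 0 by exact: axis_vec0.
have wu k : w u k = row3 (w q 0) (w q 1) 0 0 k by exact: axis_coord_vec.
have wv k : w v k = row3 (- w q 1) (w q 0) 0 0 k by exact: axis_coord_vec.
clearbody u v.
set ro := rho _ _ in rho0 *; set s := axis_dist q in s0 *; pose k := ro / s.
pose u' : 'rV[R]_4 := \row_j [:: 0; 0; k * w q 0; k * w q 1]`_j.
pose v' : 'rV[R]_4 := \row_j [:: 0; 0; - (k * w q 1); k * w q 0]`_j.
have curveE : psia \o rotation_curve q u v = rotation_curve (psia q) u' v'.
  apply/funext => x /=.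
  have wx j : w (rotation_curve q u v x) j =
      w q j + ((cos x - 1) * w u j + sin x * w v j).
    by rewrite /rotation_curve !axis_coordD !axis_coordZ.
  have w2 : w (rotation_curve q u v x) 2 = w q 2.
    by rewrite wx wu wv !mxE /=; ring.
  have rx : r (rotation_curve q u v x) = r q by exact: sph_rad_rotation_curve.
  have thx : theta O (rotation_curve q u v x) = theta O q.
    by rewrite /theta rx; congr (acos (_ / _)); exact: w2.
  have sx : axis_dist (rotation_curve q u v x) = s.
    rewrite /s /axis_dist !wx !wu !wv !mxE /=; congr (Num.sqrt _).
    have := cos2Dsin2 x; set c := cos x; set d := sin x => cd.
    by transitivity ((c ^+ 2 + d ^+ 2) * (w q 0 ^+ 2 + w q 1 ^+ 2));
      [ring | rewrite cd mul1r].
  rewrite !psi_aE rx thx sx -/ro -/s !wx !wu !wv.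
  apply/rowP => j; rewrite /rotation_curve !mxE.
  case: j => [[|[|[|[|//]]]] lj] /=; rewrite ?u0 ?v0 /k; ring.
have dv : 'D_v psia q = v'.
  have d1 : is_derive (0 : R) 1 (psia \o rotation_curve q u v)
      ('D_v psia (rotation_curve q u v 0)).
    apply: is_derive_curve (is_derive_rotation_curve q u v).
    by rewrite rotation_curve0.
  rewrite rotation_curve0 curveE in d1.
  have [_ e1] := d1; have [_ e2] := is_derive_rotation_curve (psia q) u' v'.
  exact: etrans (esym e1) e2.
have y2 : psia q 0 2 = k * w q 0 by rewrite psi_aE mxE /= -/ro -/s /k; ring.
have y3 : psia q 0 3 = k * w q 1 by rewrite psi_aE mxE /= -/ro -/s /k; ring.
have := E v v; rewrite dv form4_axisymmetric_rot; first last.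
- by rewrite drhoE y2 y3 /v' !mxE /=; ring.
- by rewrite mxE.
- by rewrite mxE.
rewrite dphiE y2 y3 form4_spherical qv v0 (dot3_axis O_orth v v) !wv.
rewrite -(sph_rad_sqr q) rq !mxE /=.
have cE : cyl_rad (psia q) ^+ 2 = k ^+ 2 * s ^+ 2.
  by rewrite cyl_rad_sqr y2 y3 /s axis_dist_sqr; ring.
have s2 := axis_dist_sqr q; rewrite -/s in s2.
have ks : k * s = ro by rewrite /k divfK // lt0r_neq0.
rewrite cE -exprMn ks.
have -> : k * w q 0 * (k * w q 0) - k * w q 1 * (- (k * w q 1)) = ro ^+ 2.
  by rewrite -ks exprMn s2; ring.
have -> : - w q 1 * - w q 1 + w q 0 * w q 0 + 0 * 0 = s ^+ 2 by rewrite s2; ring.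
move=> e; apply/eqP; rewrite -(@eqrXn2 _ 2) //; [|exact: ltW|exact: ltW].
apply/eqP; apply: etrans (etrans (esym e) _).
  by field; rewrite lt0r_neq0.
by field; rewrite lt0r_neq0.
Qed.

(** [psi_a] has linear components only on the image of [D]; this image is open, which is what allows
    the formulas to be differentiated. *)
Lemma psi_a_near p v (j : 'I_4) (f : 'rV[R]_4 -> R) : D p ->
  (forall q, (psis @` D) q -> psia q 0 j = f q) ->
  (forall h : R, f (psis p + h *: v) = f (psis p) + h * f v) ->
  ('D_v psia (psis p)) 0 j = f v.
Proof.
move=> Dp fE f_lin; have ad := psia_diff Dp.
have [_ <-] := derive_coord_line v j ad.
have [_ _ ld _ _] := psi_a_nat.
have Dq : (psis @` D) (psis p) by exists p.
have d1 : is_derive (0 : R) 1 (cst (f (psis p)) + (f v \*: id)) (0 + f v *: (1 : R)).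
  exact: is_deriveD (is_derive_cst _ _ _) (is_deriveZ _ (is_derive_id _ _)).
have [_ e1] := d1.
transitivity ('D_1 (cst (f (psis p)) + (f v \*: id)) (0 : R)); last first.
  by rewrite e1 add0r /GRing.scale /= mulr1.
apply: near_eq_derive.
apply: filterS (near_line v (local_diffeo_nbhs ld Dq)) => h qh.
by rewrite (fE _ qh) f_lin !fctE /GRing.scale /= mulrC.
Qed.

Lemma psi_a_coord2 q : (psis @` D) q -> psia q 0 2 = w q 0.
Proof.
move=> [p Dp <-]; have s0 := axis_dist_gt0 Dp.
by rewrite psi_aE mxE /= rho_axis_dist // mulrC divfK // lt0r_neq0.
Qed.

Lemma psi_a_coord3 q : (psis @` D) q -> psia q 0 3 = w q 1.
Proof.
move=> [p Dp <-]; have s0 := axis_dist_gt0 Dp.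
by rewrite psi_aE mxE /= rho_axis_dist // mulrC divfK // lt0r_neq0.
Qed.

(** These are R d/dR and R sin theta d/dtheta, scaled so that their components are polynomial in
    [w q] and [axis_dist q]. *)
Definition radial_vec q := axis_vec O (row3 (w q 0) (w q 1) (w q 2)).

Definition polar_vec q := axis_vec O
  (row3 (w q 0 * w q 2) (w q 1 * w q 2) (- axis_dist q ^+ 2)).

(* The coefficients B and C of [dz^2] and [drho^2] are eliminated from the
   values of the metric on pairs of radial and polar vectors. *)
Lemma eliminate_axis_coefs (f g ro s w2 zU zV b c : R) : ro != 0 -> s != 0 ->
  - f * (0 * 0) + g * (ro ^+ 2 * ro ^+ 2 / ro ^+ 2)
  + ro ^+ 2 * ((ro ^+ 2 - ro ^+ 2 * ro ^+ 2 / ro ^+ 2) / ro ^+ 2)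
    = b * (zU * zU) + c * (s * s) ->
  - f * (0 * 0) + g * (ro ^+ 2 * 0 / ro ^+ 2)
  + ro ^+ 2 * ((0 - ro ^+ 2 * 0 / ro ^+ 2) / ro ^+ 2)
    = b * (zU * zV) + c * (s * (s * w2)) ->
  - f * (0 * 0) + g * (0 * 0 / ro ^+ 2)
  + ro ^+ 2 * ((s ^+ 2 * ro ^+ 2 - 0 * 0 / ro ^+ 2) / ro ^+ 2)
    = b * (zV * zV) + c * (s * w2 * (s * w2)) ->
  zV != 0 /\ g * w2 * zV = - s ^+ 2 * zU.
Proof.
move=> ro0 s0'.
move=> eUU eUV eVV.
have {}eUU : g * ro ^+ 2 = b * (zU * zU) + c * (s * s).
  by apply: etrans eUU; field.
have {}eUV : 0 = b * (zU * zV) + c * (s * (s * w2)).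
  by apply: etrans eUV; field.
have {}eVV : s ^+ 2 * ro ^+ 2 = b * (zV * zV) + c * (s * w2 * (s * w2)).
  by apply: etrans eVV; field.
(* The unknown [c] cancels in the polar equation minus [w2] times the mixed one, and in [w2] times
   the radial equation minus the mixed one. The results share the factor [b * (zV - w2 * zU)]. *)
have e1 : s ^+ 2 * ro ^+ 2 = b * zV * (zV - w2 * zU).
  rewrite -[LHS](subr0) -[X in _ - X](mulr0 w2) eVV eUV; ring.
have e2 : g * ro ^+ 2 * w2 = - (b * zU * (zV - w2 * zU)).
  rewrite -[LHS](subr0) eUU eUV; ring.
split.
  apply: contra_eq_neq e1 => ->.
  by rewrite mulr0 mul0r mulf_neq0 // expf_neq0.
apply: (mulIf (expf_neq0 2 ro0)).
transitivity (g * ro ^+ 2 * w2 * zV); first ring.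
rewrite e2; transitivity (- zU * (s ^+ 2 * ro ^+ 2)); last ring.
rewrite e1; ring.
Qed.

(** Once rho = R sin theta is known, z is the only component of [psi_a] with an unknown derivative,
    and three values of the metric suffice to eliminate B and C. *)
Lemma spherical_coef_axis p : D p ->
  let q := psis p in
  'D_(polar_vec q) psia q 0 1 != 0 /\
  G (p 0 0) (r p) * w q 2 * 'D_(polar_vec q) psia q 0 1 =
  - axis_dist q ^+ 2 * 'D_(radial_vec q) psia q 0 1.
Proof.
move=> Dp q; have [c0 [A [B [C [D1 [D2 [D3 E]]]]]]] := psi_a_form Dp.
have s0 := axis_dist_gt0 Dp; rewrite -/q in c0 s0 E.
have Mp := D_tilde Dp.
have rq : r q = Rr (p 0 0) (r p) := sph_rad_psi_s Mp.
have R0 : 0 < Rr (p 0 0) (r p) by have [_ H _] := psi_nat; exact: H.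
have Dq : (psis @` D) q by exists p.
have y2 : psia q 0 2 = w q 0 := psi_a_coord2 Dq.
have y3 : psia q 0 3 = w q 1 := psi_a_coord3 Dq.
have d0 v : ('D_v psia q) 0 0 = v 0 0.
  apply: (psi_a_near (f := fun u => u 0 0)) => //.
  - by move=> u _; rewrite psi_aE mxE.
  - by move=> h; rewrite !mxE.
have d2 v : ('D_v psia q) 0 2 = w v 0.
  apply: (psi_a_near (f := fun u => w u 0)) => //; first exact: psi_a_coord2.
  by move=> h; rewrite axis_coordD axis_coordZ.
have d3 v : ('D_v psia q) 0 3 = w v 1.
  apply: (psi_a_near (f := fun u => w u 1)) => //; first exact: psi_a_coord3.
  by move=> h; rewrite axis_coordD axis_coordZ.
have cyl : cyl_rad (psia q) = axis_dist q.
  by rewrite /cyl_rad y2 y3.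
have hU : radial_vec q 0 0 = 0 by exact: axis_vec0.
have hV : polar_vec q 0 0 = 0 by exact: axis_vec0.
have wU k : w (radial_vec q) k = row3 (w q 0) (w q 1) (w q 2) 0 k.
  exact: axis_coord_vec.
have wV k : w (polar_vec q) k =
    row3 (w q 0 * w q 2) (w q 1 * w q 2) (- axis_dist q ^+ 2) 0 k.
  exact: axis_coord_vec.
have qq : dot3 q q = r q ^+ 2 by rewrite sph_rad_sqr.
have ss := axis_dist_sqr q.
move: (radial_vec q) (polar_vec q) hU hV wU wV => U V hU hV wU wV.
have E' := fun u v (hu : u 0 0 = 0) (hv : v 0 0 = 0) pu pv => etrans (etrans (esym (form4_spherical _ _ _ q u v)) (E u v))
    (form4_axisymmetric A B C D1 D2 D3 pu pv (etrans (d0 u) hu) (etrans (d0 v) hv)).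
have E2 u v (x y du dv duv : R) : u 0 0 = 0 -> v 0 0 = 0 ->
    pairing ('D_u psia q) (dphi (psia q)) = 0 ->
    pairing ('D_v psia q) (dphi (psia q)) = 0 ->
    pairing ('D_u psia q) (drho (psia q)) = x ->
    pairing ('D_v psia q) (drho (psia q)) = y ->
    dot3 q u = du -> dot3 q v = dv -> dot3 u v = duv ->
    - F (p 0 0) (r p) * (0 * 0) + G (p 0 0) (r p) * (du * dv / dot3 q q)
    + Rr (p 0 0) (r p) ^+ 2 * ((duv - du * dv / dot3 q q) / dot3 q q)
    = B (cyl_coord (psia q)) * ('D_u psia q 0 1 * 'D_v psia q 0 1)
    + C (cyl_coord (psia q)) * (x * y).
  move=> hu hv pu pv <- <- <- <- <-; apply: etrans (E' _ _ hu hv pu pv).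
  by congr (_ * (_ * _) + _ + _).
have pU : pairing ('D_U psia q) (dphi (psia q)) = 0.
  rewrite dphiE d2 d3 y2 y3 !wU !mxE /=; ring.
have pV : pairing ('D_V psia q) (dphi (psia q)) = 0.
  rewrite dphiE d2 d3 y2 y3 !wV !mxE /=; ring.
have rU : pairing ('D_U psia q) (drho (psia q)) = axis_dist q.
  rewrite drhoE d2 d3 y2 y3 cyl !wU !mxE /= -!expr2 -ss.
  by field; rewrite lt0r_neq0.
have rV : pairing ('D_V psia q) (drho (psia q)) = axis_dist q * w q 2.
  rewrite drhoE d2 d3 y2 y3 cyl !wV !mxE /=.
  have -> : w q 0 * (w q 0 * w q 2) + w q 1 * (w q 1 * w q 2) =
    axis_dist q ^+ 2 * w q 2 by rewrite ss; ring.
  by field; rewrite lt0r_neq0.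
have [dqU dUU dUV] : [/\ dot3 q U = r q ^+ 2, dot3 U U = r q ^+ 2 & dot3 U V = 0].
  rewrite -qq !(dot3_axis O_orth) !wU !wV !mxE /= ss.
  by split; ring.
have [dqV dVV] : dot3 q V = 0 /\ dot3 V V = axis_dist q ^+ 2 * r q ^+ 2.
  rewrite -qq !(dot3_axis O_orth) !wV !mxE /= ss.
  by split; ring.
have eUU := E2 U U _ _ _ _ _ hU hU pU pU rU rU dqU dqU dUU.
have eUV := E2 U V _ _ _ _ _ hU hV pU pV rU rV dqU dqV dUV.
have eVV := E2 V V _ _ _ _ _ hV hV pV pV rV rV dqV dqV dVV.
move: eUU eUV eVV; rewrite qq rq.
exact: eliminate_axis_coefs (lt0r_neq0 R0) (lt0r_neq0 s0).
Qed.

(* [psi_a] is equivariant under translations of T, so its derivatives only depend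
   on [R omega]. *)
Lemma spherical_coef_spat p p' : D p -> D p' ->
  spat (psis p) = spat (psis p') -> w (psis p) 2 != 0 ->
  G (p 0 0) (r p) = G (p' 0 0) (r p').
Proof.
move=> Dp Dp' e w2.
have [zV0 eG] := spherical_coef_axis Dp.
have [zV0' eG'] := spherical_coef_axis Dp'.
move: (psis p) (psis p') e w2 zV0 eG zV0' eG' (psia_diff Dp) (psia_diff Dp').
move=> q q' e w2 zV0 eG zV0' eG' dq dq'.
have wE k : w q' k = w q k by rewrite /axis_coord e.
have sE : axis_dist q' = axis_dist q by rewrite /axis_dist !wE.
have UE : radial_vec q' = radial_vec q by rewrite /radial_vec !wE.
have VE : polar_vec q' = polar_vec q by rewrite /polar_vec !wE sE.
have zE v : 'D_v psia q' 0 1 = 'D_v psia q 0 1.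
  have [_ e1] := derive_coord_line v 1 dq.
  have [_ e2] := derive_coord_line v 1 dq'.
  have fE : (fun h : R => psia (q' + h *: v) 0 1) =
            (fun h : R => psia (q + h *: v) 0 1).
    apply/funext => h.
    have eh : spat (q' + h *: v) = spat (q + h *: v) by rewrite !spatD e.
    have rE : r (q' + h *: v) = r (q + h *: v).
      have rS u : r u = Num.sqrt (\sum_(k < 3) spat u 0 k ^+ 2).
        rewrite /sph_rad big_mkcond big_ord_recl /= add0r.
        by congr Num.sqrt; apply: eq_bigr => k _; rewrite mxE.
      by rewrite !rS eh.
    by rewrite !psi_aE !mxE /= /theta rE eh.
  exact: etrans (esym e2) (etrans (congr1 (fun f : R -> R => 'D_1 f 0) fE) e1).
(* [b] stands for R cos theta: the equation determines G only off the equatorial plane. *)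
have key (g g' x y x' y' b b' c c' : R) : b = b' -> c = c' -> x' = x -> y' = y ->
    b != 0 -> x != 0 -> g * b * x = - c ^+ 2 * y ->
    g' * b' * x' = - c' ^+ 2 * y' -> g = g'.
  move=> <- <- -> -> b0 x0 e1 e2.
  by apply: (mulIf b0); apply: (mulIf x0); rewrite e1 e2.
apply: key (esym (wE 2)) (esym sE) _ _ w2 zV0 eG eG'; first by rewrite VE; exact: zE.
by rewrite UE; exact: zE.
Qed.

End AxisymmetricChange.

(** * Curvature of the spatial slices *)

Section Curvature.
Context {R : realType} (a : R -> R).
Hypothesis a_gt0 : forall t, 0 < t -> 0 < a t.
Hypothesis a_smooth : smooth_on [set t : R | 0 < t] a.

Implicit Types t : R.

(** This is minus the sectional curvature of the spacetime on planes tangent to the slice of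
    constant t. *)
Definition curv (t : R) : R := (1 - derive1 a t ^+ 2) / a t ^+ 2.

Definition asinh (y : R) : R := ln (y + Num.sqrt (y ^+ 2 + 1)).

Lemma cosh2_sinh2 (x : R) : cosh x ^+ 2 = sinh x ^+ 2 + 1.
Proof.
rewrite /cosh /sinh expRN; field.
by rewrite lt0r_neq0 // expR_gt0.
Qed.

Let asinh_arg_gt0 (y : R) : 0 < y + Num.sqrt (y ^+ 2 + 1).
Proof.
have s0 : 0 < Num.sqrt (y ^+ 2 + 1) by rewrite sqrtr_gt0; nra.
have : Num.sqrt (y ^+ 2 + 1) ^+ 2 = y ^+ 2 + 1 by rewrite sqr_sqrtr //; nra.
by nra.
Qed.

Lemma asinhK y : sinh (asinh y) = y.
Proof.
have y0 := asinh_arg_gt0 y.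
rewrite /sinh /asinh expRN lnK ?posrE //.
have : Num.sqrt (y ^+ 2 + 1) ^+ 2 = y ^+ 2 + 1 by rewrite sqr_sqrtr //; nra.
set s := Num.sqrt _ in y0 * => e.
have -> : (y + s)^-1 = s - y.
  by apply: (mulfI (lt0r_neq0 y0)); rewrite mulfV ?lt0r_neq0 //; nra.
by field.
Qed.

Lemma sinhK (x : R) : asinh (sinh x) = x.
Proof.
rewrite /asinh -cosh2_sinh2 sqrtr_sqr ger0_norm; last first.
  by rewrite divr_ge0 // addr_ge0 // expR_ge0.
have -> : sinh x + cosh x = expR x by rewrite /sinh /cosh; field.
exact: expRK.
Qed.

Lemma asinh_gt0 y : 0 < y -> 0 < asinh y.
Proof.
move=> y0; rewrite ln_gt0 //.
have : 1 <= Num.sqrt (y ^+ 2 + 1) by rewrite -{1}sqrtr1 ler_wsqrtr //; nra.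
by lra.
Qed.

Lemma asinh_continuous : continuous asinh.
Proof.
move=> y; apply: continuous_comp; last exact: continuous_ln.
apply: cvgD; first exact: cvg_id.
apply: continuous_comp; last exact: sqrt_continuous.
by apply: cvgD; [exact: exprn_continuous | exact: cvg_cst].
Qed.

Let D1E t : 'D_1 a t = derive1 a t. Proof. by rewrite derive1E. Qed.

Let a_diff t : 0 < t -> differentiable a t.
Proof. by move=> t0; exact: smooth_differentiable a_smooth t0. Qed.

Let da_diff t : 0 < t -> differentiable (derive1 a) t.
Proof.
have [_ /(_ 1)[H _]] := a_smooth 2; move=> t0; have := H t t0.
by have -> : (fun x : R => 'D_1 a x) = derive1 a by apply/funext.
Qed.

Let dda_continuous t : 0 < t -> {for t, continuous ('D_1 (derive1 a))}.
Proof.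
have [_ /(_ 1)[_ /(_ 1) H]] := a_smooth 2; move=> t0; have := H t t0.
by have -> : (fun x : R => 'D_1 a x) = derive1 a by apply/funext.
Qed.

(** K' is this expression times -2 / a^3. It is polynomial in a, a' and a'', so its continuity is
    immediate. *)
Let slope_ode t : R :=
  derive1 a t * ('D_1 (derive1 a) t * a t + (1 - derive1 a t ^+ 2)).

Lemma curv_derivable t : 0 < t -> derivable curv t 1.
Proof.
move=> t0; have ad : derivable a t 1 by apply/derivable1_diffP; exact: a_diff.
have bd : derivable (derive1 a) t 1 by apply/derivable1_diffP; exact: da_diff.
have -> : curv = (cst 1 - derive1 a ^+ 2) * (fun t => ((a ^+ 2) t)^-1).
  by apply/funext => x; rewrite /curv !fctE.
have a2 : (a ^+ 2) t != 0 by rewrite !fctE expf_neq0 // lt0r_neq0 // a_gt0.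
have d1 := derivableB (derivable_cst (1 : R) t 1) (derivableX (n:=2) bd).
have d2 := derivableV a2 (derivableX (n:=2) ad).
exact: derivableM d1 d2.
Qed.

Lemma curv_derive t : 0 < t -> 'D_1 curv t * a t ^+ 3 = -2 * slope_ode t.
Proof.
move=> t0; have ad : derivable a t 1 by apply/derivable1_diffP; exact: a_diff.
have bd : derivable (derive1 a) t 1 by apply/derivable1_diffP; exact: da_diff.
have kd := curv_derivable t0; have a0 := a_gt0 t0.
have e : 'D_1 (curv * a ^+ 2) t = 'D_1 (cst 1 - derive1 a ^+ 2) t.
  apply: near_eq_derive; near=> x.
  rewrite /curv !fctE divfK // expf_neq0 // lt0r_neq0 // a_gt0 //.
  by near: x; exact: lt_nbhsr.
move: e; rewrite (deriveM kd (derivableX (n:=2) ad)) (deriveX 2 ad).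
rewrite (deriveB (derivable_cst (1 : R) t 1) (derivableX (n:=2) bd)) derive_cst.
rewrite (deriveX 2 bd) D1E !fctE /GRing.scale /= !expr1 sub0r.
rewrite /slope_ode /curv; pose b : R := derive1 a t; pose b' : R := 'D_1 (derive1 a) t.
pose k' : R := 'D_1 curv t; rewrite -/b -/b' -/k' => e.
transitivity (a t * (a t ^+ 2 * k')); first ring.
have -> : a t ^+ 2 * k' = - (b * b' *+ 2) - (1 - b ^+ 2) / a t ^+ 2 * (a t * b *+ 2).
  move: e; set K := _ / _; lra.
by field; rewrite lt0r_neq0.
Unshelve. all: by end_near. Qed.

Lemma slope_ode_continuous t : 0 < t -> {for t, continuous slope_ode}.
Proof.
move=> t0; have ac := differentiable_continuous (a_diff t0).
have bc := differentiable_continuous (da_diff t0).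
apply: cvgM => //; apply: cvgD; first by apply: cvgM => //; exact: dda_continuous.
apply: cvgB; first exact: cvg_cst.
exact: (cvg_comp _ _ bc (@exprn_continuous R 2 (derive1 a t))).
Qed.

(** If [slope_ode] were nonzero at some time, it would be nonzero on an interval around it; this
    interval contains a time near which K is constant, where K' vanishes. *)
Lemma curv_constant t1 :
  (forall s1 s2, 0 < s1 -> s1 < s2 -> s2 < t1 -> exists t,
     s1 < t < s2 /\ \forall x \near t, curv x = curv t) ->
  forall s1 s2, 0 < s1 -> s1 < s2 -> s2 < t1 -> curv s1 = curv s2.
Proof.
move=> dense.
have ode t : 0 < t -> t < t1 -> slope_ode t = 0.
  move=> t0 tt1; apply: contrapT => /eqP n0.
  have : \forall x \near t, slope_ode x != 0.
    exact: cvgr_neq0 (slope_ode_continuous t0) n0.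
  move=> /nbhs_ballP[e /= e0 he].
  pose s1 := Num.max (t / 2) (t - e / 2); pose s2 := Num.min ((t + t1) / 2) (t + e / 2).
  have s1t : s1 < t by rewrite gt_max; apply/andP; split; lra.
  have ts2 : t < s2 by rewrite lt_min; apply/andP; split; lra.
  have s10 : 0 < s1 by rewrite lt_max; apply/orP; left; lra.
  have s2t : s2 < t1 by rewrite gt_min; apply/orP; left; lra.
  have s1e : t - e / 2 <= s1 by rewrite le_max lexx orbT.
  have s2e : s2 <= t + e / 2 by rewrite ge_min lexx orbT.
  have [x [/andP[s1x xs2] cx]] := dense _ _ s10 (lt_trans s1t ts2) s2t.
  have x0 : 0 < x by exact: lt_trans s1x.
  have := he x; rewrite /ball /= => /(_ _)/negP; apply.
    by rewrite ltr_norml; apply/andP; split; lra.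
  have dK : 'D_1 curv x = 0.
    transitivity ('D_1 (cst (curv x)) x); last exact: derive_cst.
    exact: near_eq_derive.
  have := curv_derive x0; rewrite dK mul0r => /esym/eqP.
  by rewrite mulf_eq0 oppr_eq0 pnatr_eq0.
move=> s1 s2 s10 s12 s2t.
have K0 t : 0 < t -> t < t1 -> 'D_1 curv t = 0.
  move=> t0 tt1; have := curv_derive t0; rewrite ode // mulr0 => /eqP.
  by rewrite mulf_eq0 expf_eq0 /= (gt_eqF (a_gt0 t0)) orbF => /eqP.
have [||c _] := @MVT_segment R curv (fun=> 0) s1 s2 (ltW s12).
- move=> x; rewrite in_itv /= => /andP[x1 x2].
  apply: DeriveDef; first by apply: curv_derivable; exact: lt_trans x1.
  by apply: K0; [exact: lt_trans x1 | exact: lt_trans s2t].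
- apply: derivable_within_continuous => x; rewrite in_itv /= => /andP[x1 x2].
  by apply: curv_derivable; exact: lt_le_trans x1.
by rewrite mul0r => /eqP; rewrite subr_eq0 => /eqP ->.
Qed.

Lemma curv_constant_slope (a'0 : \bar R) t1 k : 0 < t1 ->
  a t @[t --> 0^'+] --> (0 : R) ->
  (derive1 a t)%:E @[t --> 0^'+] --> a'0 -> (0 <= a'0)%E ->
  (forall t, 0 < t -> t < t1 -> curv t = k) -> a'0 = 1%E.
Proof.
move=> t10 a_lim a'_lim a'0_ge0 kE.
have sq_lim : derive1 a t ^+ 2 @[t --> 0^'+] --> (1 : R).
  have a2 : a t ^+ 2 @[t --> 0^'+] --> (0 ^+ 2 : R).
    exact: (cvg_comp _ _ a_lim (@exprn_continuous R 2 0)).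
  have : 1 - k * a t ^+ 2 @[t --> 0^'+] --> (1 - k * 0 ^+ 2 : R).
    apply: cvgB; first exact: cvg_cst.
    exact: cvgMl_tmp a2.
  rewrite expr0n mulr0 subr0; apply: cvg_trans; apply: near_eq_cvg; near=> t.
  have t0 : 0 < t by near: t; exact: nbhs_right_gt.
  have tt1 : t < t1 by near: t; exact: nbhs_right_lt.
  rewrite -(kE t t0 tt1) /curv divfK; first by ring.
  by rewrite expf_neq0 // lt0r_neq0 // a_gt0.
(* The squares of a' tend to 1. An infinite limit would push them above 4, and the finite limit -1
   is excluded by the sign. *)
case: a'0 a'_lim a'0_ge0 => [l| |//]; last first.
  move=> /cvgey_gt /(_ 2) H _.
  have h1 : \forall t \near 0^'+, derive1 a t ^+ 2 < 4.
    by apply: (cvgr_lt _ sq_lim); lra.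
  have [t [/= h2]] := filter_ex (filterI h1 H).
  by rewrite lte_fin => h3; exfalso; nra.
move=> /fine_cvg /= l_lim; rewrite lee_fin => l0.
have l2 : derive1 a t ^+ 2 @[t --> 0^'+] --> (l ^+ 2 : R).
  exact: (cvg_comp _ _ l_lim (@exprn_continuous R 2 l)).
have /eqP : l ^+ 2 = 1 by apply: cvg_unique l2 sq_lim => //; exact: norm_hausdorff.
rewrite sqrf_eq1 => /orP[/eqP -> //|/eqP l1].
by rewrite l1 in l0; exfalso; lra.
Unshelve. all: by end_near. Qed.

End Curvature.

(** * Local constancy of K along curves of fixed area radius *)

Section LocalConstancy.
Context {R : realType} (a : R -> R) (T Rr F G : R -> R -> R).
Hypothesis a_gt0 : forall t, 0 < t -> 0 < a t.
Hypothesis a_smooth : smooth_on [set t : R | 0 < t] a.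
Hypothesis psi_nat : natural_spherical_change a T Rr F G.
Context (O : 'M[R]_3) (z rho : R -> R -> R) (D : set 'rV[R]_4).
Hypothesis psi_a_nat : natural_axisymmetric_change a T Rr G O z rho D.

Local Notation r := (@sph_rad R).

Lemma spherical_coef_curv p : flrw_tilde a p ->
  G (p 0 0) (r p) * (1 + Rr (p 0 0) (r p) ^+ 2 * curv a (p 0 0)) = 1.
Proof.
move=> Mp; apply: etrans (spherical_coef_inv a_gt0 a_smooth psi_nat Mp).
have A0 : a (p 0 0) != 0 by rewrite lt0r_neq0 // a_gt0 //; have [] := Mp.
rewrite (area_radius a_gt0 psi_nat Mp) cosh2_sinh2 /curv.
congr (_ * _); move: (a (p 0 0)) (sinh (r p)) (derive1 a (p 0 0)) A0 => A S b A0.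
by field.
Qed.

Lemma axis_coord_psi_s p k :
  axis_coord O (psi_s T Rr p) k = Rr (p 0 0) (r p) / r p * axis_coord O p k.
Proof.
rewrite /axis_coord; have -> : spat (psi_s T Rr p) = (Rr (p 0 0) (r p) / r p) *: spat p.
  by apply/rowP => j; rewrite /spat /psi_s !mxE /=; ring.
by rewrite -scalemxAl mxE.
Qed.

(* The points [sigma t] have the same value of [R omega], so G takes the same
   value at all of them. *)
Lemma curv_locally_constant p : D p -> axis_coord O p 2 != 0 ->
  \forall t \near p 0 0, curv a t = curv a (p 0 0).
Proof.
move=> Dp w2; have [_ D_tilde _ _ _] := psi_a_nat.
have [Mp _] := D_tilde _ Dp; have t00 : 0 < p 0 0 by have [] := Mp.
have rp := flrw_tilde_sph_rad_gt0 Mp; set t0 := p 0 0 in t00 *.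
have A0 := a_gt0 t00; have S0 := sinh_gt0 rp.
pose R0 := a t0 * sinh (r p); have R00 : 0 < R0 by rewrite mulr_gt0.
(* [x t] solves a(t) sinh(x) = R0, so [sigma] moves along the ray of [p] at fixed area radius. *)
pose x t := asinh (R0 / a t); pose e0 : 'rV[R]_4 := delta_mx 0 0.
pose sigma t : 'rV[R]_4 := t *: e0 + x t *: drad p.
have sx : x t0 = r p by rewrite /x /R0 mulrAC mulfV ?mul1r ?sinhK // lt0r_neq0.
have s0 : sigma t0 = p.
  apply/rowP => j; rewrite /sigma sx !mxE /=; case: (eqVneq j 0) => [->|_] /=.
    by rewrite mulr1 mulr0 addr0.
  by rewrite mulr0 add0r mulrC divfK // lt0r_neq0.
have xc : x t @[t --> t0] --> x t0.
  have ac : a t @[t --> t0] --> a t0.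
    exact: (differentiable_continuous (smooth_differentiable a_smooth t00)).
  have qc : R0 / a t @[t --> t0] --> R0 / a t0.
    by apply: cvgMl_tmp; apply: cvgV ac; rewrite lt0r_neq0.
  exact: (cvg_comp _ _ qc (@asinh_continuous R _)).
have sc : sigma t @[t --> t0] --> p.
  rewrite -[X in _ --> X]s0; apply: cvgD; first by apply: cvgZr_tmp; exact: cvg_id.
  exact: cvgZr_tmp.
have nDp := D_nbhs psi_a_nat Dp.
have nD : \forall t \near t0, D (sigma t) := sc _ nDp.
have n0 : \forall t \near t0, 0 < t by exact: lt_nbhsr.
have sigma0 t : sigma t 0 0 = t by rewrite /sigma !mxE /= mulr1 mulr0 addr0.
apply: filterS2 n0 nD => t tgt0 Dt.
have [Mt _] := D_tilde _ Dt.
have xt0 : 0 < x t by apply: asinh_gt0; rewrite divr_gt0 // a_gt0.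
have rt : r (sigma t) = x t.
  apply/eqP; rewrite -(@eqrXn2 _ 2) ?sph_rad_ge0 ?ltW // sph_rad_sqr /sigma.
  rewrite !(dot3Dl, dot3Dr) !(dot3Zl, dot3Zr) (dot3C _ e0).
  have e0v v : dot3 e0 v = 0 by rewrite /dot3 /e0 !mxE /=; ring.
  rewrite !e0v dot3_drad dot3C dot3_drad -sph_rad_sqr; apply/eqP; field.
  by rewrite lt0r_neq0.
have Rt : Rr (sigma t 0 0) (r (sigma t)) = R0.
  rewrite (area_radius a_gt0 psi_nat Mt) rt sigma0 asinhK mulrC divfK //.
  by rewrite lt0r_neq0 // a_gt0.
have Rp : Rr t0 (r p) = R0 by rewrite (area_radius a_gt0 psi_nat Mp).
have es : spat (psi_s T Rr p) = spat (psi_s T Rr (sigma t)).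
  have psE u j : spat (psi_s T Rr u) 0 j =
      Rr (u 0 0) (r u) * (u 0 (lift 0 j) / r u) by rewrite !mxE.
  apply/rowP => j; rewrite !psE -/t0 Rt Rp rt /sigma !mxE /=.
  by rewrite mulr0 add0r; field; rewrite !lt0r_neq0.
have w2' : axis_coord O (psi_s T Rr p) 2 != 0.
  rewrite axis_coord_psi_s -/t0 Rp; apply: mulf_neq0 => //.
  by rewrite lt0r_neq0 // divr_gt0.
have eG := spherical_coef_spat psi_nat psi_a_nat Dp Dt es w2'.
have e1 := spherical_coef_curv Mp; have e2 := spherical_coef_curv Mt.
rewrite -/t0 Rp in e1; rewrite Rt -eG sigma0 -/t0 in e2.
have G0 : G t0 (r p) != 0.
  by apply: contra_eq_neq e1 => ->; rewrite mul0r eq_sym oner_neq0.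
apply: (mulfI (expf_neq0 2 (lt0r_neq0 R00))); apply: (addrI 1).
by apply: (mulfI G0); rewrite e1 e2.
Qed.

End LocalConstancy.

(** * Open mapping *)

Section InverseFunction.
Context {R : realType}.

Lemma derive_littleo (V W : normedModType R) (f : V -> W) x (e : R) : 0 < e ->
  differentiable f x ->
  \forall k \near (0 : V), `|f (k + x) - f x - 'D_k f x| <= e * `|k|.
Proof.
move=> e0 fd.
have := diff_locally fd; set o := the_littleo _ _ _ _ _ => E.
have oP : \forall k \near (0 : V), `|o k| <= e * `|k|.
  by have /(_ _ e0) := littleoP o.
apply: filterS oP => k; rewrite deriveE //.
have -> : f (k + x) = f x + 'd f x k + o k := congr1 (fun g : V -> W => g k) E.
have zmodE (A B C : W) : A + B + C - A - B = C.
  by rewrite -addrA -opprD addrAC subrr add0r.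
by rewrite zmodE.
Qed.

(** The curve is only known to be continuous, but its image under [F] is affine near [d0]. As [F]
    has identity differential at [c d0], its first-order expansion there determines the increments
    of [c] up to a small relative error. *)
Lemma inverse_curve_derive (V : normedModType R) (F : V -> V) (c : R -> V)
    (u : V) (d0 : R) :
  differentiable F (c d0) -> (forall v, 'D_v F (c d0) = v) ->
  {for d0, continuous c} ->
  (\forall h \near (0 : R), F (c (d0 + h)) = F (c d0) + h *: u) ->
  is_derive d0 1 c u.
Proof.
move=> Fd F1 cc FE.
suff H : (fun h : R => h^-1 *: ((c \o shift d0) (h *: (1 : R)) - c d0)) @ 0^' --> u.
  by apply: DeriveDef; [exact: cvgP H | exact: cvg_lim H].
apply/cvgrPdist_le => e e0.
(* With eta at most 1/2, the error term eta |k| is absorbed and |k| <= 2 |h| |u|; the other bound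
   then makes the error at most e |h|. *)
pose eta := Num.min (1 / 2) (e / (2 * (`|u| + 1))).
have u0 := normr_ge0 u.
have eta0 : 0 < eta by rewrite lt_min divr_gt0 //= divr_gt0 // mulr_gt0 //; lra.
have eta1 : eta <= 1 / 2 by rewrite ge_min lexx.
have eta2 : 2 * eta * `|u| <= e.
  have : eta <= e / (2 * (`|u| + 1)) by rewrite ge_min lexx orbT.
  rewrite ler_pdivlMr; last by lra.
  by nra.
have kc : (fun h : R => c (d0 + h) - c d0) @ (0 : R) --> (0 : V).
  rewrite -(subrr (c d0)); apply: cvgB; last exact: cvg_cst.
  have sc : (fun h : R => d0 + h) @ (0 : R) --> d0.
    by rewrite -[X in _ --> X]addr0; apply: cvgD; [exact: cvg_cst | exact: cvg_id].
  exact: (cvg_comp _ _ sc cc).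
have near_k := kc _ (derive_littleo eta0 Fd).
have : \forall h \near (0 : R), h != 0 ->
    `|u - h^-1 *: ((c \o shift d0) (h *: (1 : R)) - c d0)| <= e.
  apply: filterS2 FE near_k => h FEh /=.
  rewrite F1 subrK FEh (addrC (F _)) addrK => hk h0.
  have -> : h *: (1 : R) = h by rewrite /GRing.scale /= mulr1.
  rewrite (addrC h).
  move: (c (d0 + h) - c d0) hk => k hk.
  have hn : 0 < `|h| by rewrite normr_gt0.
  have -> : u - h^-1 *: k = h^-1 *: (h *: u - k).
    by rewrite scalerBr scalerA mulVf // scale1r.
  rewrite normrZ normfV mulrC ler_pdivrMr //.
  have k1 : `|k| <= `|h| * `|u| + eta * `|k|.
    rewrite -normrZ; apply: le_trans (lerD (lexx _) hk).
    by rewrite -{1}[k](subKr (h *: u)) (le_trans (ler_normB _ _)).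
  have k0 := normr_ge0 k.
  have k2 : `|k| <= 2 * (`|h| * `|u|) by nra.
  apply: le_trans hk _.
  have hu0 : 0 <= `|h| * `|u| by rewrite mulr_ge0.
  by nra.
by move=> H; rewrite /nbhs /= /dnbhs /within /=; exact: H.
Qed.

Lemma norm_coord_le n (v : 'rV[R]_n) j : `|v 0 j| <= `|v|.
Proof.
rewrite [leRHS]/Num.Def.normr /= mx_normrE.
by have := @le_bigmax _ _ _ 0 (fun ij : 'I_1 * 'I_n => `|v ij.1 ij.2|) (0, j).
Qed.

Lemma norm_row_le n (v : 'rV[R]_n) e : 0 <= e ->
  (forall j, `|v 0 j| <= e) -> `|v| <= e.
Proof.
move=> e0 H; rewrite [leLHS]/Num.Def.normr /= mx_normrE.
by apply: bigmax_le => // -[i j] _ /=; rewrite ord1.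
Qed.

(** The norm on rows is the maximum norm, which is not differentiable; the minimisation in
    [open_map] needs the Euclidean square. *)
Definition sqnorm (v : 'rV[R]_4) : R := \sum_(j < 4) v 0 j ^+ 2.

Lemma sqnormE v :
  sqnorm v = v 0 0 ^+ 2 + v 0 1 ^+ 2 + v 0 2 ^+ 2 + v 0 3 ^+ 2.
Proof. exact: sum_ord4. Qed.

Lemma sqnorm_ge0 v : 0 <= sqnorm v.
Proof. by rewrite sumr_ge0 // => j _; exact: sqr_ge0. Qed.

Lemma sqnorm_eq0 v : sqnorm v = 0 -> v = 0.
Proof.
move=> /eqP; rewrite psumr_eq0 => [/allP H|j _]; last exact: sqr_ge0.
apply/rowP => j; rewrite mxE; have := H j (mem_index_enum j).
by rewrite sqrf_eq0 => /eqP.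
Qed.

Lemma sub_cst_continuous (V W : normedModType R) (f : V -> W) y' y :
  {for y, continuous f} -> {for y, continuous (fun z => f z - y')}.
Proof. by move=> fc; apply: cvgB => //; exact: cvg_cst. Qed.

Lemma sqnorm_continuous : continuous sqnorm.
Proof.
have -> : sqnorm = (fun v => v 0 0 ^+ 2 + v 0 1 ^+ 2 + v 0 2 ^+ 2 + v 0 3 ^+ 2).
  by apply/funext => v; exact: sqnormE.
have sqc j : continuous (fun v : 'rV[R]_4 => v 0 j ^+ 2).
  move=> v; exact: (cvg_comp _ _ (@coord_continuous R 1 4 0 j v)
    (@exprn_continuous R 2 _)).
by move=> v; exact: (cvgD (cvgD (cvgD (sqc 0 v) (sqc 1 v)) (sqc 2 v)) (sqc 3 v)).
Qed.

Lemma row_perp_unit (A : 'M[R]_4) (u : 'rV[R]_4) : A \in unitmx ->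
  (forall v : 'rV[R]_4, \sum_(j < 4) u 0 j * (v *m A) 0 j = 0) -> u = 0.
Proof.
move=> uA H; apply: sqnorm_eq0; by rewrite -(H (u *m invmx A)) mulmxKV.
Qed.

Lemma box_compact n (lo hi : 'I_n -> R) :
  compact [set y : 'rV[R]_n | forall i, lo i <= y 0 i <= hi i].
Proof.
have -> : [set y : 'rV[R]_n | forall i, lo i <= y 0 i <= hi i] =
    [set y : 'rV[R]_n | forall i, [set` `[lo i, hi i]] (y 0 i)].
  by apply/seteqP; split => y Hy i; have := Hy i; rewrite /= in_itv.
apply: (@rV_compact R n (fun i => [set` `[lo i, hi i]])) => i.
exact: segment_compact.
Qed.

(** For [y'] near [f x], the squared distance from [f] to [y'] is minimised over a closed box around
    [x]. By injectivity the values of [f] on the faces of the box stay away from [f x], so the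
    minimiser is interior. There the gradient vanishes, and the invertible Jacobian forces the value
    [y']. *)
Lemma open_map (U : set 'rV[R]_4) (f : 'rV[R]_4 -> 'rV[R]_4) x :
  open U -> (forall y, U y -> differentiable f y) -> set_inj U f ->
  (forall y, U y -> 'J f y \in unitmx) -> U x -> nbhs (f x) (f @` U).
Proof.
move=> oU fd finj fJ Ux.
have /nbhs_ballP[e /= e0 xe] : nbhs x U by exact: open_nbhs_nbhs.
have fc y : U y -> {for y, continuous f}.
  by move=> /fd; exact: differentiable_continuous.
pose e2 := e / 2; have e20 : 0 < e2 by rewrite divr_gt0.
pose B := [set y : 'rV[R]_4 | forall i,
  x 0 i - e2 <= y 0 i <= x 0 i + e2].
have cB : compact B by exact: box_compact.
have Bn y : B y <-> `|y - x| <= e2.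
  split=> [By|yx i].
    apply: norm_row_le => [|i]; first exact: ltW.
    rewrite !mxE ler_norml; by have := By i => /andP[? ?]; apply/andP; split; lra.
  have := norm_coord_le (y - x) i => /le_trans/(_ yx).
  by rewrite !mxE ler_norml => /andP[? ?]; apply/andP; split; lra.
have BU y : B y -> U y.
  move=> /Bn yx; apply: xe; rewrite -ball_normE /= distrC.
  by apply: le_lt_trans yx _; rewrite /e2; lra.
have psi_c y' : {within B, continuous (fun y => sqnorm (f y - y'))}.
  apply: continuous_in_subspaceT => y; rewrite inE => /BU Uy.
  have h := sub_cst_continuous (y' := y') (fc _ Uy).
  exact: (cvg_comp _ _ h (@sqnorm_continuous _)).
pose S := B `&` [set y | `|y - x| = e2].
have cS : compact S.
  apply: compact_closedI => //.
  apply: (@preimage_closed _ _ (fun y : 'rV[R]_4 => `|y - x|) [set e2]).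
    move=> y _; have h := @sub_cst_continuous 'rV[R]_4 _ id x y (@cvg_id _ _).
    exact: cvg_norm h.
  exact: closed_eq.
have [m m0 Sm] : exists2 m, 0 < m & forall y, S y -> m <= sqnorm (f y - f x).
  have [S0|S0] := pselect (S !=set0); last first.
    by exists 1 => // y Sy; exfalso; apply: S0; exists y.
  have SB : S `<=` B by move=> y [].
  have [c] := compact_EVT_min S0 cS (continuous_subspaceW SB (psi_c (f x))).
  rewrite inE => Sc Hc; exists (sqnorm (f c - f x)).
    rewrite lt_neqAle sqnorm_ge0 andbT eq_sym; apply/eqP => /sqnorm_eq0/eqP.
    rewrite subr_eq0 => /eqP e1; have cx : c = x.
      by apply: finj; rewrite ?inE //; apply: BU; case: Sc.
    by move: Sc => [_ /= ]; rewrite cx subrr normr0 => /eqP; rewrite lt_eqF.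
  by move=> y Sy; apply: Hc; rewrite inE.
(* A minimiser [c] on a face would give m <= |f c - f x|^2 <= 2 |f c - y'|^2 + 2 |y' - f x|^2 <= 4
   |y' - f x|^2 < m. *)
have near_y : \forall y' \near f x, sqnorm (y' - f x) < m / 4.
  have h := @sub_cst_continuous 'rV[R]_4 _ id (f x) (f x) (@cvg_id _ _).
  have H : (fun y' => sqnorm (y' - f x)) @ f x --> sqnorm (f x - f x).
    exact: (cvg_comp _ _ h (@sqnorm_continuous _)).
  have z0 : sqnorm (f x - f x) < m / 4.
    rewrite /sqnorm big1 => [|j _]; first by rewrite divr_gt0.
    by rewrite !mxE subrr expr0n.
  by move: z0; apply: (cvgr_lt _ H).
apply: filterS near_y => y' hy'.
have Bx : B x by apply/Bn; rewrite subrr normr0 ltW.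
have [c] := compact_EVT_min (ex_intro _ x Bx) cB (psi_c y').
rewrite inE => Bc Hc; exists c; first exact: BU.
have cint : `|c - x| < e2.
  rewrite lt_neqAle; apply/andP; split; last exact/Bn.
  apply/eqP => ce; have := Sm c (conj Bc ce); rewrite leNgt => /negP; apply.
  have := Hc x; rewrite inE => /(_ Bx) h.
  have hN : sqnorm (f x - y') = sqnorm (y' - f x).
    by apply: eq_bigr => j _; rewrite !mxE -sqrrN opprB.
  have : sqnorm (f c - f x) <= 2 * sqnorm (f c - y') + 2 * sqnorm (y' - f x).
    rewrite /sqnorm !mulr_sumr -big_split /=; apply: ler_sum => j _.
    rewrite !mxE; move: (f c 0 j) (f x 0 j) (y' 0 j) => p q z.
    rewrite -subr_ge0; have -> : 2 * (p - z) ^+ 2 + 2 * (z - q) ^+ 2 - (p - q) ^+ 2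
      = (p + q - 2 * z) ^+ 2 by ring.
    exact: sqr_ge0.
  by lra.
suff D v : \sum_(j < 4) (f c - y') 0 j * ('D_v f c) 0 j = 0.
  apply/eqP; rewrite -subr_eq0; apply/eqP.
  apply: (row_perp_unit (fJ c (BU _ Bc))) => v; apply: etrans (D v).
  by apply: eq_bigr => j _; rewrite (deriveEjacobian v (fd _ (BU _ Bc))).
have bc : nbhs c (ball x e2).
  apply: open_nbhs_nbhs; split; first exact: ball_open.
  by rewrite -ball_normE /= distrC.
rewrite -ball_normE in bc; have near0 := near_line v bc.
have /nbhs_ballP[dl /= dl0 Hdl] := near0.
have Bh (h : R) : `|h| < dl -> B (c + h *: v).
  move=> hd; apply/Bn; apply: ltW; rewrite distrC.
  by apply: Hdl; rewrite -ball_normE /= sub0r normrN.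
pose psi (h : R) := sqnorm (f (c + h *: v) - y').
have dpsi (h0 : R) : `|h0| < dl -> is_derive h0 1 psi
    (\sum_(j < 4) (2 * (f (c + h0 *: v) - y') 0 j) * ('D_v f (c + h0 *: v)) 0 j).
  move=> hd; have fdh := fd _ (BU _ (Bh _ hd)).
  have fdc := is_derive_curve fdh (is_derive_line c v h0).
  have -> : psi = \sum_(j < 4) ((fun h : R => f (c + h *: v) 0 j) - cst (y' 0 j)) ^+ 2.
    by apply/funext => h; rewrite fct_sumE; apply: eq_bigr => j _; rewrite !mxE.
  apply: is_derive_sum => j.
  have fdj : is_derive h0 1 (fun h : R => f (c + h *: v) 0 j)
      (('D_v f (c + h0 *: v)) 0 j).
    have [cd cv] := fdc; apply: DeriveDef.
      by move/derivable_mxP : cd => /(_ 0 j).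
    by rewrite -cv; exact: derive_coord cd.
  apply: (is_derive_eq (is_deriveX 2 (is_deriveB fdj (is_derive_cst (y' 0 j) h0 1)))).
  by rewrite subr0 /GRing.scale /= !fctE !mxE expr1.
have dl_in (h : R) : h \in `](- dl), dl[ -> `|h| < dl.
  by rewrite in_itv /= ltr_norml.
have H0 : is_derive (0 : R) 1 psi 0.
  apply: (@derive1_at_min R psi (- dl) dl 0); first lra.
  - by move=> t /dl_in/dpsi[].
  - by rewrite in_itv /=; apply/andP; split; lra.
  - move=> t /dl_in td; rewrite /psi scale0r addr0; apply: Hc; rewrite inE.
    exact: Bh.
have D0 := dpsi 0; rewrite normr0 in D0; have [_ e1] := D0 dl0.
have [_ e2'] := H0; rewrite e2' scale0r addr0 in e1.
apply: (mulfI (_ : (2 : R) != 0)); first by rewrite pnatr_eq0.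
rewrite mulr0 mulr_sumr [RHS]e1; apply: eq_bigr => j _; ring.
Qed.

End InverseFunction.

(** * Timelike segments near the boundary *)

Section Convergence.
Context {R : realType}.

Lemma cvg_sum4 {T : Type} (F : set_system T) {FF : Filter F}
    (f : 'I_4 -> T -> R) (l : 'I_4 -> R) :
  (forall i, f i x @[x --> F] --> l i) ->
  \sum_(i < 4) f i x @[x --> F] --> \sum_(i < 4) l i.
Proof.
move=> fl; rewrite sum_ord4.
have -> : (fun x => \sum_(i < 4) f i x) = (fun x => f 0 x + f 1 x + f 2 x + f 3 x).
  by apply/funext => x; rewrite sum_ord4.
exact: (cvgD (cvgD (cvgD (fl 0) (fl 1)) (fl 2)) (fl 3)).
Qed.

Lemma form4E (h : 'M[R]_4) v w :
  form4 h v w = \sum_(j < 4) (\sum_(i < 4) v 0 i * h i j) * w 0 j.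
Proof. by rewrite /form4 mxE; apply: eq_bigr => j _; rewrite !mxE. Qed.

Lemma form4_cvg {T : Type} (F : set_system T) {FF : Filter F}
    (h : T -> 'M[R]_4) (v w : T -> 'rV[R]_4) h0 v0 w0 :
  h x @[x --> F] --> h0 -> v x @[x --> F] --> v0 -> w x @[x --> F] --> w0 ->
  form4 (h x) (v x) (w x) @[x --> F] --> form4 h0 v0 w0.
Proof.
move=> hh vv ww; rewrite form4E.
have -> : (fun x => form4 (h x) (v x) (w x)) =
    (fun x => \sum_(j < 4) (\sum_(i < 4) v x 0 i * h x i j) * w x 0 j).
  by apply/funext => x; rewrite form4E.
have vc i : v x 0 i @[x --> F] --> v0 0 i.
  exact: (cvg_comp _ _ vv (@coord_continuous R 1 4 0 i v0)).
have wc i : w x 0 i @[x --> F] --> w0 0 i.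
  exact: (cvg_comp _ _ ww (@coord_continuous R 1 4 0 i w0)).
have hc i j : h x i j @[x --> F] --> h0 i j.
  exact: (cvg_comp _ _ hh (@coord_continuous R 4 4 i j h0)).
apply: cvg_sum4 => j; apply: cvgM (wc j).
by apply: cvg_sum4 => i; exact: cvgM (vc i) (hc i j).
Qed.

Lemma form4Zl (h : 'M[R]_4) k v w : form4 h (k *: v) w = k * form4 h v w.
Proof. by rewrite /form4 -!scalemxAl mxE. Qed.

Lemma form4Zr (h : 'M[R]_4) k v w : form4 h v (k *: w) = k * form4 h v w.
Proof. by rewrite /form4 linearZ -scalemxAr mxE. Qed.

Lemma Ck_cst (V W : normedModType R) k (U : set V) (w : W) :
  Ck k U (fun=> w).
Proof.
elim: k w => [|k IH] w /=; first by move=> x _; exact: cvg_cst.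
split=> [x _|v]; first exact: differentiable_cst.
have -> : (fun x => 'D_v (fun=> w) x) = (fun=> 0).
  by apply/funext => x; exact: derive_cst.
exact: IH.
Qed.

Lemma smooth_line (V : normedModType R) (U : set R) (x v : V) :
  smooth_on U (fun h : R => x + h *: v).
Proof.
have ld (h : R) : differentiable (fun h : R => x + h *: v) h.
  by have [/derivable1_diffP] := is_derive_line x v h.
case=> [|k] /=; first by move=> h _; exact: differentiable_continuous.
split=> [h _ //|k0].
have -> : (fun h : R => 'D_k0 (fun h : R => x + h *: v) h) = (fun=> k0 *: v).
  apply/funext => h; have [_ e1] := is_derive_line x v h.
  by rewrite deriveE // -[X in 'd _ _ X](mulr1 k0) linearZ /= -deriveE // e1.
exact: Ck_cst.
Qed.

End Convergence.

Section Causality.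
Context {R : realType} (E : spacetime R) (M : set 'rV[R]_4)
  (iota : 'rV[R]_4 -> E).
Hypothesis M_open : open M.
Hypothesis emb : smooth_embedding M iota.

Local Notation A := (iota @` M).

Lemma chart_at (q : E) : exists2 c : chart R E, atlas c & chart_dom c q.
Proof. by have [H _ _] := spacetime_smooth E; exact: H. Qed.

Lemma preimage_nbhs (V : set E) p : M p -> nbhs (iota p) V ->
  nbhs p (M `&` iota @^-1` V).
Proof.
have [_ ic _ _ _] := emb => Mp Vp; apply: filterI; first exact: open_nbhs_nbhs.
exact: ic.
Qed.

Lemma chart_preimage_open (c : chart R E) : open (M `&` iota @^-1` chart_dom c).
Proof.
rewrite openE => p [Mp dp]; apply: preimage_nbhs => //.
by apply: open_nbhs_nbhs; split => //; exact: open_dom.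
Qed.

Lemma embedding_image_open : open A.
Proof.
have [inj ic _ sm un] := emb; rewrite openE => q [p Mp <-].
have [c ac dc] := chart_at (iota p).
set U := M `&` iota @^-1` chart_dom c.
have fU : nbhs (to_coord c (iota p)) ((to_coord c \o iota) @` U).
  apply: open_map => //.
  - exact: chart_preimage_open.
  - by move=> y Uy; exact: smooth_differentiable (sm c ac) Uy.
  - move=> x y; rewrite !inE => -[Mx dx] [My dy] /= e.
    apply: inj; rewrite ?inE //.
    by rewrite -(to_coordK dx) -(to_coordK dy) e.
  - by move=> y [My dy]; exact: un.
have n1 := to_coord_continuous dc fU.
have n2 : nbhs (iota p) (chart_dom c).
  by apply: open_nbhs_nbhs; split => //; exact: open_dom.
apply: filterS2 n2 n1 => y dy [x [Mx dx] /= e].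
by exists x => //; rewrite -(to_coordK dx) -(to_coordK dy) e.
Qed.

(** An open image without boundary points is also closed, so connectedness would make it the whole
    spacetime. *)
Lemma embedding_boundary_nonempty : M !=set0 -> A <> [set: E] ->
  boundary A !=set0.
Proof.
move=> [p Mp] nA; apply: contrapT => nb; apply: nA.
have oA := embedding_image_open.
have cA : closed A.
  move=> q cq; apply: contrapT => nq; apply: nb; exists q; split => //.
  by move=> /interior_subset.
apply: (spacetime_connected (s := E)).
- by exists (iota p); exists p.
- by exists A => //; rewrite setTI.
- by exists A => //; rewrite setTI.
Qed.

(** The conditions are strict inequalities in continuous data, so one radius serves for the base
    point and the direction simultaneously. *)
Lemma future_cone (c : chart R E) x0 : atlas c -> chart_cod c x0 ->
  exists2 e : R, 0 < e & forall x v, `|x - x0| < e -> `|v - tor c x0| < e ->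
    chart_cod c x /\ future_timelike c x v.
Proof.
move=> ac cx0.
have [mc _ _] := spacetime_metric ac.
have [tc tt _] := spacetime_time_orientation ac.
set tau := tor c x0.
have c1 : (fun z : 'rV[R]_4 * 'rV[R]_4 => metric c z.1) @ (x0, tau) --> metric c x0.
  exact: (cvg_comp _ _ (@cvg_fst _ _ (nbhs x0) (nbhs tau) _) (mc _ cx0)).
have c2 : (fun z : 'rV[R]_4 * 'rV[R]_4 => tor c z.1) @ (x0, tau) --> tau.
  exact: (cvg_comp _ _ (@cvg_fst _ _ (nbhs x0) (nbhs tau) _) (tc _ cx0)).
have c3 : (fun z : 'rV[R]_4 * 'rV[R]_4 => z.2) @ (x0, tau) --> tau.
  exact: (@cvg_snd _ _ (nbhs x0) (nbhs tau) _).
have t0 := tt _ cx0.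
have n1 : \forall z \near (x0, tau), form4 (metric c z.1) z.2 z.2 < 0.
  by move: t0; apply: (cvgr_lt _ (form4_cvg c1 c3 c3)).
have n2 : \forall z \near (x0, tau), form4 (metric c z.1) z.2 (tor c z.1) < 0.
  by move: t0; apply: (cvgr_lt _ (form4_cvg c1 c3 c2)).
have n3 : \forall z \near (x0, tau), chart_cod c z.1.
  have n : nbhs x0 (chart_cod c).
    by apply: open_nbhs_nbhs; split => //; exact: open_cod.
  exact: (@cvg_fst _ _ (nbhs x0) (nbhs tau) _ _ n).
have n4 : \forall z \near (x0, tau), chart_cod c z.1 /\
    (form4 (metric c z.1) z.2 z.2 < 0 /\ form4 (metric c z.1) z.2 (tor c z.1) < 0).
  by apply: filterI n3 _; exact: filterI n1 n2.
have /nbhs_ballP[e /= e0 He] := n4.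
exists e => // x v xe ve; have [] := He (x, v).
  by split; rewrite -ball_normE /= distrC.
by move=> /= ? [].
Qed.

Lemma future_timelikeZ (c : chart R E) x v k : 0 < k ->
  future_timelike c x v -> future_timelike c x (k *: v).
Proof.
move=> k0 [h1 h2]; split; first by rewrite form4Zl form4Zr !pmulr_rlt0.
by rewrite form4Zl pmulr_rlt0.
Qed.

Hypothesis no_future_boundary : forall q, ~ future_boundary M iota q.

(** Otherwise let s be the infimum of the parameters outside the image. As the image is open, the
    point at s is not in it and s > 0; the segment up to s, rescaled to [0, 1], then exhibits that
    point as one of the future boundary. *)
Lemma future_segment (c : chart R E) y v : atlas c ->
  (forall u : R, 0 <= u <= 1 ->
     chart_cod c (y + u *: v) /\ future_timelike c (y + u *: v) v) ->
  A (of_coord c y) -> A (of_coord c (y + v)).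
Proof.
move=> ac seg A0; apply: contrapT => nA1.
have oA := embedding_image_open.
pose gam (u : R) := of_coord c (y + u *: v).
have gc u : 0 <= u <= 1 -> {for u, continuous gam}.
  move=> u01; have [cu _] := seg u u01.
  have [/derivable1_diffP/differentiable_continuous lc _] := is_derive_line y v u.
  exact: (cvg_comp _ _ lc (of_coord_continuous cu)).
pose S := [set u : R | 0 <= u <= 1 /\ ~ A (gam u)].
have S1 : S 1 by split; [rewrite ler01 lexx | rewrite /gam scale1r].
have lS : lbound S 0 by move=> u [/andP[]].
have hS : has_inf S by split; [exists 1 | exists 0].
set s := inf S.
have s0 : 0 <= s by apply: lb_le_inf; [exists 1 | exact: lS].
have s1 : s <= 1 by apply: ge_inf; [exists 0|].
have s01 : 0 <= s <= 1 by rewrite s0 s1.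
have below u : 0 <= u -> u < s -> A (gam u).
  move=> u0 us; apply: contrapT => nu.
  have : s <= u by apply: ge_inf; [exists 0 | split => //; rewrite u0 /=; lra].
  by lra.
have near_gam (B : set E) : nbhs (gam s) B ->
    exists2 e : R, 0 < e & forall u, `|u - s| < e -> B (gam u).
  move=> /(gc s s01)/nbhs_ballP[e /= e0 He]; exists e => // u ue.
  by apply: He; rewrite -ball_normE /= distrC.
have nAs : ~ A (gam s).
  move=> As; have [e e0 He] := near_gam _ (open_nbhs_nbhs (conj oA As)).
  have [u [u01 nu] ue] := inf_adherent e0 hS.
  have su : s <= u by apply: ge_inf; [exists 0|].
  by apply: nu; apply: He; rewrite ger0_norm; rewrite -/s in ue; lra.
have sgt0 : 0 < s.
  rewrite lt_neqAle s0 andbT; apply/eqP => e; apply: nAs.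
  by rewrite -e /gam scale0r addr0.
apply: (@no_future_boundary (gam s)); split.
  split; last by move=> /interior_subset.
  move=> B /near_gam[e e0 He].
  pose u := Num.max 0 (s - e / 2).
  have u0 : 0 <= u by rewrite le_max lexx.
  have us : u < s by rewrite gt_max sgt0 /=; lra.
  have ue : s - e / 2 <= u by rewrite le_max lexx orbT.
  exists (gam u); split; first exact: below.
  by apply: He; rewrite ler0_norm; lra.
exists (fun u : R => gam (u * s)); split; last 2 first.
- by rewrite mul1r.
- move=> u /andP[u0 u1]; apply: below; first by rewrite mulr_ge0.
  by rewrite -[X in _ < X]mul1r ltr_pM2r.
exists 1%N, (fun i => i%:R); split => // -[|//] _; split; first exact: ltr01.
move=> u /andP[u0 u1]; exists c, (fun h : R => y + h *: (s *: v)), 1.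
have us h : 0 <= h -> h <= 1 -> 0 <= h * s <= 1.
  by move=> h0 h1; rewrite mulr_ge0 //= -[X in _ <= X]mulr1 ler_pM.
split => //; first exact: smooth_line.
- move=> h /andP[h0 h1] _; have [cu _] := seg _ (us h h0 h1).
  split; first exact: of_coord_dom.
  by rewrite /gam of_coordK // scalerA.
- have [_ ->] := is_derive_line y (s *: v) u.
  rewrite scalerA; apply: future_timelikeZ => //.
  by have [] := seg _ (us u u0 u1).
Qed.

(* A timelike segment into the future of a boundary point stays in the image:
   it can be approached by segments that start in the image and, as there is no
   future boundary, never leave it. *)
Lemma boundary_future p0 : boundary A p0 ->
  exists (c : chart R E) (x0 : 'rV[R]_4) (dl : R),
  [/\ atlas c, chart_cod c x0, of_coord c x0 = p0, 0 < dl &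
   forall d : R, 0 < d <= dl -> [/\ chart_cod c (x0 + d *: tor c x0),
     future_timelike c (x0 + d *: tor c x0) (tor c x0) &
     A (of_coord c (x0 + d *: tor c x0))]].
Proof.
move=> [cl _]; have [c ac dc] := chart_at p0.
set x0 := to_coord c p0; have cx0 : chart_cod c x0 by exact: to_coord_cod.
have [e e0 cone] := future_cone ac cx0.
set tau := tor c x0 in cone *; have t0 := normr_ge0 tau.
pose dl := e / (2 * (`|tau| + 1)).
have dl0 : 0 < dl by rewrite divr_gt0 // mulr_gt0 //; lra.
have dlt d : 0 < d -> d <= dl -> `|d *: tau| < e / 2.
  move=> d0 ddl; rewrite normrZ gtr0_norm //.
  have : dl * (2 * (`|tau| + 1)) = e by rewrite /dl divfK //; apply: lt0r_neq0; lra.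
  by nra.
exists c, x0, dl; split => //; first exact: to_coordK.
move=> d /andP[d0 ddl]; have [cd fd] : chart_cod c (x0 + d *: tau) /\
    future_timelike c (x0 + d *: tau) tau.
  apply: cone; last by rewrite subrr normr0.
  by rewrite addrAC subrr add0r; have := dlt d d0 ddl; lra.
split => //.
(* The bound e / 2 keeps the segment from [y] in the domain of [cone]. The bound d e controls its
   direction: divided by d, this is tau + (x0 - y) / d, within e of tau. *)
pose eta := Num.min (e / 2) (d * e).
have eta0 : 0 < eta by rewrite lt_min divr_gt0 //= mulr_gt0.
have [q [Aq [dq qe]]] : exists q, A q /\ chart_dom c q /\ `|to_coord c q - x0| < eta.
  have n1 : nbhs p0 (chart_dom c).
    by apply: open_nbhs_nbhs; split => //; exact: open_dom.
  have n2 := to_coord_continuous dc (nbhsx_ballx x0 eta eta0).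
  have [q [Aq [dq qe]]] := cl _ (filterI n1 n2).
  by exists q; split => //; split => //; move: qe; rewrite /= -ball_normE /= distrC.
set y := to_coord c q in qe *.
have [qe1 qe2] : `|y - x0| < e / 2 /\ `|y - x0| < d * e.
  by move: qe; rewrite lt_min => /andP[].
have -> : x0 + d *: tau = y + (x0 + d *: tau - y).
  by rewrite [RHS]addrCA subrr addr0.
apply: future_segment => //; last by rewrite to_coordK.
move=> u /andP[u0 u1].
pose w := tau + d^-1 *: (x0 - y).
have dw : d *: w = d *: tau + (x0 - y).
  by rewrite /w scalerDr scalerA mulfV ?scale1r // lt0r_neq0.
have -> : x0 + d *: tau - y = d *: w by rewrite dw addrAC addrC.
have [cu fu] : chart_cod c (y + u *: (d *: w)) /\
    future_timelike c (y + u *: (d *: w)) w.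
  apply: cone.
    have -> : y + u *: (d *: w) - x0 = (1 - u) *: (y - x0) + u *: (d *: tau).
      by rewrite dw; apply/rowP => j; rewrite !mxE; ring.
    apply: le_lt_trans (ler_normD _ _) _; rewrite (normrZ (1 - u)) (normrZ u).
    rewrite (ger0_norm u0) ger0_norm; last by lra.
    have h1 := dlt d d0 ddl; have h2 := normr_ge0 (y - x0).
    have h3 := normr_ge0 (d *: tau).
    have : (1 - u) * `|y - x0| <= `|y - x0| by nra.
    have : u * `|d *: tau| <= `|d *: tau| by nra.
    by lra.
  rewrite /w addrAC subrr add0r normrZ distrC normfV gtr0_norm //.
  by rewrite mulrC ltr_pdivrMr // mulrC.
by split => //; exact: future_timelikeZ.
Qed.

End Causality.

(** * Lorentzian algebra *)

Section LorentzAlgebra.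
Context {R : realType}.
Implicit Types p u v w : 'rV[R]_4.

Lemma dot3_cauchy_schwarz v w : dot3 v w ^+ 2 <= dot3 v v * dot3 w w.
Proof.
rewrite -subr_ge0 /dot3; set a1 := v 0 1; set a2 := v 0 2; set a3 := v 0 3.
set b1 := w 0 1; set b2 := w 0 2; set b3 := w 0 3.
have -> : (a1 * a1 + a2 * a2 + a3 * a3) * (b1 * b1 + b2 * b2 + b3 * b3) -
    (a1 * b1 + a2 * b2 + a3 * b3) ^+ 2 =
    (a1 * b2 - a2 * b1) ^+ 2 + (a1 * b3 - a3 * b1) ^+ 2 + (a2 * b3 - a3 * b2) ^+ 2.
  by ring.
by rewrite !addr_ge0 ?sqr_ge0.
Qed.

Lemma dot3_ge0 v : 0 <= dot3 v v.
Proof. by rewrite -sph_rad_sqr sqr_ge0. Qed.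

Lemma coord_sqr_le_dot3 v (j : 'I_4) : j != 0 -> v 0 j ^+ 2 <= dot3 v v.
Proof.
move=> j0; have : j = 1 \/ j = 2 \/ j = 3.
  by case: j j0 => [[|[|[|[|//]]]] lj] j0;
    [by [] | left | right; left | right; right]; apply/val_inj.
by rewrite /dot3 => -[->|[->|->]]; nra.
Qed.

Let timelike_dot v w : dot3 v v < v 0 0 ^+ 2 -> dot3 w w < w 0 0 ^+ 2 ->
  dot3 v w ^+ 2 < (v 0 0 * w 0 0) ^+ 2.
Proof.
move=> v0 w0; have cs := dot3_cauchy_schwarz v w.
have hv := dot3_ge0 v; have hw := dot3_ge0 w.
rewrite exprMn; apply: le_lt_trans cs _; nra.
Qed.

Let same_cone v u : dot3 v v < v 0 0 ^+ 2 -> dot3 u u < u 0 0 ^+ 2 ->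
  dot3 v u - v 0 0 * u 0 0 < 0 -> 0 < v 0 0 * u 0 0.
Proof.
move=> hv hu hvu; have := timelike_dot hv hu.
by rewrite ltNge => /negP h; rewrite ltNge; apply/negP => h2; apply: h; nra.
Qed.

Lemma form4_diag v w :
  form4 (diag_mx (\row_(j < 4) (if j == 0 then -1 else 1))) v w =
  dot3 v w - v 0 0 * w 0 0.
Proof.
rewrite /form4 mul_mx_diag mxE sum_ord4 !mxE /= /dot3; ring.
Qed.

(** In a frame diagonalising [h], two timelike vectors with negative product have time components of
    the same sign, by Cauchy-Schwarz. The role of [u] is played by the orientation field of [E],
    which relates d/dt to the velocity of a pulled back segment. *)
Lemma future_cone_convex (h : 'M[R]_4) u v w : lorentzian h ->
  form4 h u u < 0 -> form4 h v v < 0 -> form4 h w w < 0 ->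
  form4 h v u < 0 -> form4 h w u < 0 -> form4 h v w < 0.
Proof.
move=> [_ [P uP hP]].
have E x y : form4 h x y =
    dot3 (x *m invmx P) (y *m invmx P) - (x *m invmx P) 0 0 * (y *m invmx P) 0 0.
  by rewrite -form4_diag -hP form4_pull !mulmxKV.
rewrite !E; move: (u *m _) (v *m _) (w *m _) => {}u {}v {}w.
rewrite !subr_lt0 -!expr2 => uu vv ww vu wu.
have vu0 : 0 < v 0 0 * u 0 0 by apply: same_cone => //; rewrite subr_lt0.
have wu0 : 0 < w 0 0 * u 0 0 by apply: same_cone => //; rewrite subr_lt0.
have vw0 : 0 < v 0 0 * w 0 0 by nra.
by have := timelike_dot vv ww; nra.
Qed.

Lemma sinh_ge_half (x : R) : 0 <= x -> x / 2 <= sinh x.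
Proof.
move=> x0; have h1 := expR_ge1Dx x.
have h2 : expR (- x) <= 1 by rewrite -expR0 ler_expR oppr_le0.
by rewrite /sinh ler_pM2r ?invr_gt0 //; lra.
Qed.

Lemma form4_flrw_time (a : R -> R) p w :
  form4 (flrw_metric a p) (flrw_future p) w = - w 0 0.
Proof.
have e0v v : dot3 (flrw_future p) v = 0 by rewrite /dot3 /flrw_future !mxE /=; ring.
have e00 : flrw_future p 0 0 = 1 by rewrite /flrw_future mxE.
have [rp|rp] := eqVneq (sph_rad p) 0; last first.
  by rewrite form4_flrw // (dot3C p (flrw_future p)) !e0v e00; ring.
rewrite /flrw_metric rp eqxx form4D (form4Z (_ ^+ 2)) form4N form4_euclid3 form4_sq.
by rewrite !dcoordE e0v e00; ring.
Qed.

(** In normal coordinates the hyperbolic metric dominates a multiple of the Euclidean one; the crude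
    factor 1/4 comes from sinh x >= x / 2. Timelike vectors thus have spatial components bounded by
    their time component. *)
Lemma form4_flrw_ge (a : R -> R) p w :
  - w 0 0 ^+ 2 + a (p 0 0) ^+ 2 / 4 * dot3 w w <= form4 (flrw_metric a p) w w.
Proof.
have ww := dot3_ge0 w; have A2 := sqr_ge0 (a (p 0 0)).
have [rp|rp] := eqVneq (sph_rad p) 0.
  rewrite /flrw_metric rp eqxx form4D (form4Z (_ ^+ 2)) form4N form4_euclid3 form4_sq.
  by rewrite !dcoordE -expr2; nra.
rewrite form4_flrw //.
have r0 : 0 < sph_rad p by rewrite lt_neqAle eq_sym rp sph_rad_ge0.
have pp0 : 0 < dot3 p p by rewrite -sph_rad_sqr exprn_gt0.
have cs := dot3_cauchy_schwarz p w; rewrite mulrC -ler_pdivrMr // in cs.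
have s0 := sinh_ge_half (ltW r0).
have s1 : 1 / 4 <= sinh (sph_rad p) ^+ 2 / dot3 p p.
  by rewrite ler_pdivlMr // -sph_rad_sqr; nra.
rewrite -!expr2; set k := _ / dot3 p p in s1.
set d := dot3 p w ^+ 2 / _ in cs *; set A := a _ ^+ 2 in A2 *.
have -> : A * sinh (sph_rad p) ^+ 2 * ((dot3 w w - d) / dot3 p p) =
  A * (k * (dot3 w w - d)) by rewrite /k; ring.
have d0 : 0 <= d by rewrite divr_ge0 ?sqr_ge0 // ltW.
have : 1 / 4 * (dot3 w w - d) <= k * (dot3 w w - d).
  by rewrite ler_wpM2r // subr_ge0.
set x := k * _ => hx.
have : A / 4 * dot3 w w <= A * d + A * x.
  by rewrite -mulrA -mulrDr ler_wpM2l //; lra.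
by lra.
Qed.

End LorentzAlgebra.

Lemma derive_nondecreasing {R : realType} (g dg : R -> R) (l d1 d2 : R) :
  (forall x, l < x <= d2 -> is_derive x 1 g (dg x) /\ 0 <= dg x) ->
  l < d1 -> d1 <= d2 -> g d1 <= g d2.
Proof.
move=> H ld d12.
have [||c] := @MVT_segment R g dg d1 d2 d12.
- move=> x; rewrite in_itv /= => /andP[x1 x2]; apply: (proj1 (H x _)).
  by apply/andP; split; [exact: lt_trans x1 | exact: ltW].
- apply: derivable_within_continuous => x; rewrite in_itv /= => /andP[x1 x2].
  by have [|[]] := H x; first by apply/andP; split => //; exact: lt_le_trans x1.
rewrite in_itv /= => /andP[c1 c2] e.
have [|_ h] := H c; first by apply/andP; split => //; exact: lt_le_trans c1.
by rewrite -subr_ge0 e mulr_ge0 // subr_ge0.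
Qed.

(** * Boundary points are at time 0 *)

Section BoundaryCurve.
Context {R : realType} (a : R -> R) (E : spacetime R) (iota : 'rV[R]_4 -> E).
Hypothesis a_gt0 : forall t, 0 < t -> 0 < a t.
Hypothesis a_smooth : smooth_on [set t : R | 0 < t] a.
Hypothesis ext :
  C0_extension (@flrw_domain R) (flrw_metric a) (@flrw_future R) iota.
Hypothesis no_future_boundary :
  forall q, ~ future_boundary (@flrw_domain R) iota q.

Local Notation M := (@flrw_domain R).
Local Notation A := (iota @` M).

Let emb : smooth_embedding M iota. Proof. by have [] := ext. Qed.

Lemma flrw_domain_open : open M.
Proof.
have -> : M = (fun p : 'rV[R]_4 => p 0 0) @^-1` [set t | 0 < t] by [].
apply: open_comp; last exact: open_gt.
by move=> p _; exact: (@coord_continuous R 1 4 0 0 p).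
Qed.

Section Pullback.
Context (c : chart R E) (x0 : 'rV[R]_4) (dl : R).
Hypothesis ac : atlas c.
Local Notation tau := (tor c x0).
Local Notation seg := (fun d : R => x0 + d *: tau).
Hypothesis segP : forall d : R, 0 < d <= dl -> [/\ chart_cod c (seg d),
  future_timelike c (seg d) tau & A (of_coord c (seg d))].
Context (sigma : R -> 'rV[R]_4).
Hypothesis sigmaP : forall d : R, 0 < d <= dl ->
  M (sigma d) /\ iota (sigma d) = of_coord c (seg d).

Let seg_continuous d : {for d, continuous seg}.
Proof.
by have [/derivable1_diffP/differentiable_continuous] := is_derive_line x0 tau d.
Qed.

(** [sigma] is chosen point by point; continuity comes from [iota] being open onto its image. *)
Lemma pullback_continuous d : 0 < d -> d < dl -> {for d, continuous sigma}.
Proof.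
move=> d0 ddl; have [inj _ op _ _] := emb.
have hd : 0 < d <= dl by rewrite d0 ltW.
have [Md ed] := sigmaP hd; have [cd _ _] := segP hd.
move=> W; rewrite nbhsE => -[W' [oW' W'd] W'W].
have [||O oO eO] := op (W' `&` M).
- exact: openI oW' flrw_domain_open.
- by move=> x [].
have Od : O (of_coord c (seg d)).
  have [] : (O `&` A) (iota (sigma d)) by rewrite -eO; exists (sigma d).
  by rewrite ed.
have n1 : \forall x \near d, O (of_coord c (seg x)).
  exact: (cvg_comp _ _ (@seg_continuous d) (of_coord_continuous cd) _
    (open_nbhs_nbhs (conj oO Od))).
have n2 : \forall x \near d, 0 < x by exact: lt_nbhsr.
have n3 : \forall x \near d, x < dl by exact: lt_nbhsl.
apply: filterS3 n1 n2 n3 => x Ox x0' xdl.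
have hx : 0 < x <= dl by rewrite x0' ltW.
have [Mx ex] := sigmaP hx.
have : (O `&` A) (iota (sigma x)) by rewrite ex; split => //; exists (sigma x).
rewrite -eO => -[y [W'y My] e]; apply: W'W.
by rewrite -(inj y (sigma x)) ?inE.
Qed.

(** [iota] in the chart maps [sigma] to a straight segment; composing with the inverse differential
    gives the normalisation of [inverse_curve_derive]. By isometry the velocity is timelike, which
    bounds its spatial part, and future directed, which makes its time component positive. *)
Lemma pullback_derive d : 0 < d -> d < dl -> exists w : 'rV[R]_4,
  [/\ is_derive d 1 sigma w, 0 < w 0 0 &
      a (sigma d 0 0) ^+ 2 / 4 * dot3 w w <= w 0 0 ^+ 2].
Proof.
move=> d0 ddl; have [inj _ _ sm un] := emb.
have hd : 0 < d <= dl by rewrite d0 ltW.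
have [Md ed] := sigmaP hd; have [cd [fd1 fd2] _] := segP hd.
have dd : chart_dom c (iota (sigma d)) by rewrite ed; exact: of_coord_dom.
pose f := to_coord c \o iota.
have fd : differentiable f (sigma d) by exact: smooth_differentiable (sm c ac) _.
have uJ : 'J f (sigma d) \in unitmx by exact: un.
have fs x : 0 < x <= dl -> f (sigma x) = seg x.
  move=> hx; have [_ ex] := sigmaP hx; have [cx _ _] := segP hx.
  by rewrite /f /= ex of_coordK.
pose L := invmx ('J f (sigma d)).
pose rowL (u : 'rV[R]_4) : 'rV[R]_4 := u *m L.
have rowL_lin (x v : 'rV[R]_4) (h : R) : rowL (x + h *: v) = rowL x + h *: rowL v.
  by rewrite /rowL mulmxDl scalemxAl.
have rowLd x : differentiable rowL x.
  have -> : rowL = \sum_(i < 4) (fun u : 'rV[R]_4 => u 0 i *: row i L).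
    by apply/funext => u; rewrite fct_sumE /rowL mulmx_sum_row.
  apply: differentiable_sum => i; apply: differentiableZl.
  exact: differentiable_coord.
have rowLD x v : 'D_v rowL x = rowL v.
  by apply: derive_affine => // h; exact: rowL_lin.
pose w := rowL tau; exists w.
have dw : is_derive d 1 sigma w.
  apply: (@inverse_curve_derive _ _ (rowL \o f)).
  - exact: differentiable_comp.
  - move=> v; rewrite (derive_comp v fd (rowLd _)) rowLD.
    by rewrite (deriveEjacobian v fd) /rowL /L mulmxK.
  - exact: pullback_continuous.
  - have n1 : \forall h \near (0 : R), 0 < d + h by exact: near0_gt.
    have n2 : \forall h \near (0 : R), h < dl - d by apply: lt_nbhsl; lra.
    apply: filterS2 n1 n2 => h h1 h2 /=.
    rewrite !fs ?hd //; last by apply/andP; split; lra.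
    by rewrite -rowL_lin scalerDl addrA.
have wJ : w *m 'J f (sigma d) = tau by rewrite /w /rowL /L mulmxKV.
have fE := fs _ hd.
have [_ gE Xfut _] := ext.
have met v1 v2 : form4 (flrw_metric a (sigma d)) v1 v2 =
    form4 (metric c (seg d)) (v1 *m 'J f (sigma d)) (v2 *m 'J f (sigma d)).
  by rewrite (gE c (sigma d) ac Md dd) form4_pull -fE.
have [X1 X2] := Xfut c (sigma d) ac Md dd; rewrite -/f in X1 X2.
have [_ lor _] := spacetime_metric ac.
have [_ tt _] := spacetime_time_orientation ac.
have ww : form4 (flrw_metric a (sigma d)) w w < 0 by rewrite met wJ.
have e0w : form4 (flrw_metric a (sigma d)) (flrw_future (sigma d)) w < 0.
  rewrite met wJ; apply: (future_cone_convex (u := tor c (seg d)) (lor _ cd)) => //.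
  - exact: tt.
  - by rewrite -fE.
  - by rewrite -fE.
rewrite form4_flrw_time oppr_lt0 in e0w; split => //.
by have := form4_flrw_ge a (sigma d) w; lra.
Qed.

Lemma pullback_speed : exists w : R -> 'rV[R]_4, forall d, 0 < d -> d < dl ->
  [/\ is_derive d 1 sigma (w d), 0 < w d 0 0 &
      a (sigma d 0 0) ^+ 2 / 4 * dot3 (w d) (w d) <= w d 0 0 ^+ 2].
Proof.
have H d : exists w : 'rV[R]_4, 0 < d -> d < dl -> [/\ is_derive d 1 sigma w,
    0 < w 0 0 & a (sigma d 0 0) ^+ 2 / 4 * dot3 w w <= w 0 0 ^+ 2].
  have [[d0 dd]|nd] := pselect (0 < d /\ d < dl); last first.
    by exists 0 => d0 dd; exfalso; apply: nd.
  by have [w Hw] := pullback_derive d0 dd; exists w.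
by have [w Hw] := choice H; exists w.
Qed.

Lemma is_derive_coord (f : R -> 'rV[R]_4) (d : R) (w : 'rV[R]_4) (j : 'I_4) :
  is_derive d 1 f w -> is_derive d 1 (fun x => f x 0 j) (w 0 j).
Proof.
move=> [fd fe]; apply: DeriveDef; first by move/derivable_mxP : fd => /(_ 0 j).
by rewrite -fe; exact: derive_coord fd.
Qed.

Lemma pullback_time_mono d1 d2 : 0 < d1 -> d1 <= d2 -> d2 < dl ->
  sigma d1 0 0 <= sigma d2 0 0.
Proof.
move=> d10 d12 d2l; have [w wP] := pullback_speed.
apply: (@derive_nondecreasing _ (fun d => sigma d 0 0) (fun d => w d 0 0) 0) => //.
move=> x /andP[x0' xd2]; have [sd w0 _] := wP x x0' (le_lt_trans xd2 d2l).
by split; [exact: is_derive_coord | exact: ltW].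
Qed.

(* Otherwise the curve stays in a compact box of M, whose image is closed, and
   its limit point lies in the image. *)
Lemma pullback_time_inf s : 0 < dl -> chart_cod c x0 ->
  ~ A (of_coord c x0) -> 0 < s -> exists2 d, 0 < d < dl & sigma d 0 0 < s.
Proof.
move=> dl0 cx0 nA s0; apply: contrapT => H.
have tge d : 0 < d -> d < dl -> s <= sigma d 0 0.
  move=> d0 dd; rewrite leNgt; apply/negP => h; apply: H.
  by exists d => //; rewrite d0.
have [w wP] := pullback_speed.
pose d1 := dl / 2; have d10 : 0 < d1 by rewrite divr_gt0.
have d1l : d1 < dl by rewrite /d1; lra.
pose t1 := sigma d1 0 0; have st1 : s <= t1 by exact: tge.
have ac' : {within `[s, t1], continuous a}.
  apply: derivable_within_continuous => x; rewrite in_itv /= => /andP[x1 _].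
  by apply: (a_derivable a_smooth); exact: lt_le_trans x1.
have [x1 x1in x1min] := EVT_min st1 ac'.
have m0 : 0 < a x1.
  by apply: a_gt0; move: x1in; rewrite in_itv /= => /andP[h _]; exact: lt_le_trans h.
(* From a^2 / 4 |w|^2 <= w_0^2 and a >= a(x1) on [s, t1], each spatial component of the velocity is
   at most L w_0. *)
pose L := 2 / a x1; have L0 : 0 < L by rewrite divr_gt0.
have speed d (j : 'I_4) : j != 0 -> 0 < d -> d <= d1 -> `|w d 0 j| <= L * w d 0 0.
  move=> j0 d0 dd; have dl' : d < dl by exact: le_lt_trans d1l.
  have [_ w0 hw] := wP d d0 dl'.
  have ha : a x1 <= a (sigma d 0 0).
    apply: x1min; rewrite in_itv /= tge //=; exact: pullback_time_mono.
  have hj := coord_sqr_le_dot3 (w d) j0.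
  have h2 : a x1 ^+ 2 * w d 0 j ^+ 2 <= 4 * w d 0 0 ^+ 2.
    have : a x1 ^+ 2 <= a (sigma d 0 0) ^+ 2 by rewrite lerXn2r // nnegrE ltW // a_gt0 // (lt_le_trans s0) // tge.
    have := sqr_ge0 (w d 0 j); have := sqr_ge0 (a x1); nra.
  have -> : L * w d 0 0 = 2 * w d 0 0 / a x1 by rewrite /L; ring.
  rewrite ler_pdivlMr //.
  have p1 : 0 <= `|w d 0 j| * a x1 by rewrite mulr_ge0 // ltW.
  have p2 : 0 <= 2 * w d 0 0 by rewrite mulr_ge0 // ltW.
  have e1 : (`|w d 0 j| * a x1) ^+ 2 = a x1 ^+ 2 * w d 0 j ^+ 2.
    by rewrite exprMn real_normK ?num_real // mulrC.
  have e2 : (2 * w d 0 0) ^+ 2 = 4 * w d 0 0 ^+ 2 by ring.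
  by rewrite -(@ler_pXn2r _ 2) ?nnegrE // e1 e2.
have bound d (j : 'I_4) : j != 0 -> 0 < d -> d <= d1 ->
    sigma d1 0 j - L * t1 <= sigma d 0 j <= sigma d1 0 j + L * t1.
  move=> j0 d0 dd.
  (* Taken with e = 1 and e = -1: both L t + x_j and L t - x_j are nondecreasing along the curve. *)
  have side (e : R) : `|e| <= 1 ->
      L * sigma d 0 0 + e * sigma d 0 j <= L * sigma d1 0 0 + e * sigma d1 0 j.
    move=> e1; apply: (@derive_nondecreasing _
      (fun d => L * sigma d 0 0 + e * sigma d 0 j)
      (fun d => L * w d 0 0 + e * w d 0 j) 0) => //.
    move=> x /andP[x0' xd1]; have [sd w0 _] := wP x x0' (le_lt_trans xd1 d1l).
    split.
      exact: (is_deriveD (is_deriveZ L (is_derive_coord 0 sd))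
        (is_deriveZ e (is_derive_coord j sd))).
    have h1 := speed x j j0 x0' xd1.
    have h2 : `|e * w x 0 j| <= `|w x 0 j|.
      by rewrite normrM ler_piMl.
    have := ler_norm (- (e * w x 0 j)); rewrite normrN; lra.
  have st : 0 <= sigma d 0 0 by apply: le_trans (tge d d0 (le_lt_trans dd d1l)); exact: ltW.
  have ls : 0 <= L * sigma d 0 0 by rewrite mulr_ge0 // ltW.
  have s1 := side 1; have s2 := side (-1); rewrite normrN normr1 lexx in s1 s2.
  by have := s1 isT; have := s2 isT; rewrite -/t1 => ? ?; apply/andP; split; lra.
pose lo (i : 'I_4) := if i == 0 then s else sigma d1 0 i - L * t1.
pose hi (i : 'I_4) := if i == 0 then t1 else sigma d1 0 i + L * t1.
have cB := @box_compact R _ lo hi; set B := [set y : 'rV[R]_4 | _] in cB.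
have BM : B `<=` M.
  by move=> y /(_ 0); rewrite /lo eqxx => /andP[h _]; exact: lt_le_trans h.
have [_ ic _ _ _] := emb.
have cI : closed (iota @` B).
  apply: compact_closed; first exact: spacetime_hausdorff.
  apply: continuous_compact cB; apply: continuous_in_subspaceT => y.
  by rewrite inE => /BM; exact: ic.
have sB d : 0 < d -> d <= d1 -> B (sigma d).
  move=> d0 dd i; rewrite /lo /hi; have [->|i0] := eqVneq i 0; last exact: bound.
  rewrite tge //=; last exact: le_lt_trans d1l.
  exact: pullback_time_mono.
apply: nA; suff [y By <-] : (iota @` B) (of_coord c x0) by exists y => //; exact: BM.
apply: cI => W Wp.
have sc : {for 0, continuous (fun d : R => of_coord c (seg d))}.
  have cx0' : {for seg 0, continuous (of_coord c)}.
    by rewrite scale0r addr0; exact: of_coord_continuous.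
  exact: (cvg_comp _ _ (@seg_continuous 0) cx0').
have W0 : nbhs (of_coord c (seg 0)) W by rewrite scale0r addr0.
have /nbhs_ballP[e /= e0 He] := sc _ W0.
pose d := Num.min (e / 2) d1.
have d0 : 0 < d by rewrite lt_min d10 divr_gt0.
have dd1 : d <= d1 by rewrite ge_min lexx orbT.
have de : d <= e / 2 by rewrite ge_min lexx.
exists (iota (sigma d)); split; first by exists (sigma d) => //; exact: sB.
have [_ ->] : M (sigma d) /\ iota (sigma d) = of_coord c (seg d).
  by apply: sigmaP; rewrite d0 /=; lra.
by apply: He; rewrite -ball_normE /= sub0r normrN gtr0_norm //; lra.
Qed.

End Pullback.

(** Along the pulled back segment t is continuous and takes arbitrarily small values, so it takes
    every value below the one at [d1], which is chosen small enough for the segment up to [d1] to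
    lie in [V]. *)
Lemma boundary_times p0 (V : set E) : boundary A p0 -> nbhs p0 V ->
  exists2 t1 : R, 0 < t1 & forall s, 0 < s -> s < t1 ->
    exists q : 'rV[R]_4, [/\ M q, q 0 0 = s & V (iota q)].
Proof.
move=> bp Vp.
have [c [x0 [dl [ac cx0 ex0 dl0 segP]]]] :=
  boundary_future flrw_domain_open emb no_future_boundary bp.
have nA : ~ A (of_coord c x0).
  rewrite ex0 => Ap; case: bp => _; apply; apply: open_nbhs_nbhs; split => //.
  exact: embedding_image_open flrw_domain_open emb.
have H d : exists p : 'rV[R]_4, 0 < d <= dl ->
    M p /\ iota p = of_coord c (x0 + d *: tor c x0).
  have [hd|nd] := pselect (0 < d <= dl); last by exists 0.
  by have [_ _ [p Mp e]] := segP d hd; exists p.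
have [sigma sigmaP] := choice H.
have sc : {for 0, continuous (fun d : R => of_coord c (x0 + d *: tor c x0))}.
  have [/derivable1_diffP/differentiable_continuous lc _] :=
    is_derive_line x0 (tor c x0) 0.
  have cx0' : {for (x0 + (0 : R) *: tor c x0), continuous (of_coord c)}.
    by rewrite scale0r addr0; exact: of_coord_continuous.
  exact: (cvg_comp _ _ lc cx0').
have W0 : nbhs (of_coord c (x0 + (0 : R) *: tor c x0)) V.
  by rewrite scale0r addr0 ex0.
have /nbhs_ballP[e /= e0 He] := sc _ W0.
pose d1 := Num.min (e / 2) (dl / 2).
have d10 : 0 < d1 by rewrite lt_min !divr_gt0.
have d1l : d1 < dl.
  have : d1 <= dl / 2 by rewrite ge_min lexx orbT.
  by lra.
have d1e : d1 <= e / 2 by rewrite ge_min lexx.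
exists (sigma d1 0 0); first by have [] := sigmaP d1; rewrite ?d10 ?ltW.
move=> s s0 st.
have [d2 /andP[d20 d2l] td2] := pullback_time_inf ac segP sigmaP dl0 cx0 nA s0.
have d21 : d2 <= d1.
  rewrite leNgt; apply/negP => h.
  have := pullback_time_mono ac segP sigmaP d10 (ltW h) d2l; lra.
have cs : {within `[d2, d1], continuous (fun d => sigma d 0 0)}.
  apply: continuous_in_subspaceT => x; rewrite inE /= in_itv /= => /andP[x1 x2].
  have sx := pullback_continuous segP sigmaP (lt_le_trans d20 x1) (le_lt_trans x2 d1l).
  exact: (cvg_comp _ _ sx (@coord_continuous R 1 4 0 0 _)).
have [|d3 d3in ed3] := IVT d21 cs (v := s).
  rewrite ge_min le_max (ltW td2) (ltW st) orbT /=; by [].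
move: d3in; rewrite in_itv /= => /andP[h1 h2].
have d30 : 0 < d3 by exact: lt_le_trans h1.
have d3l : d3 < dl by exact: le_lt_trans d1l.
have [M3 e3] : M (sigma d3) /\ iota (sigma d3) = of_coord c (x0 + d3 *: tor c x0).
  by apply: sigmaP; rewrite d30 ltW.
exists (sigma d3); split => //; rewrite e3.
by apply: He; rewrite -ball_normE /= sub0r normrN gtr0_norm //; lra.
Qed.

End BoundaryCurve.

(** * Density of the axisymmetric coordinates *)

Section Genericity.
Context {R : realType}.
Implicit Types p q u v : 'rV[R]_4.

Lemma quadratic_nonroot (k b c e : R) : k != 0 -> 0 < e ->
  exists2 h, 0 < h < e & k * h ^+ 2 + b * h + c != 0.
Proof.
move=> k0 e0; apply: contrapT => H.
have root h : 0 < h -> h < e -> k * h ^+ 2 + b * h + c = 0.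
  move=> h0 he; apply/eqP; apply: contrapT => /negP n0; apply: H.
  by exists h => //; rewrite h0.
(* The second difference of the quadratic at three equally spaced points isolates its leading
   coefficient. *)
have r1 := root (e / 4); have r2 := root (e / 2); have r3 := root (3 * e / 4).
have {}r1 := r1 ltac:(lra) ltac:(lra); have {}r2 := r2 ltac:(lra) ltac:(lra).
have {}r3 := r3 ltac:(lra) ltac:(lra).
have : k * (e ^+ 2 / 8) = (k * (e / 4) ^+ 2 + b * (e / 4) + c)
  - 2 * (k * (e / 2) ^+ 2 + b * (e / 2) + c)
  + (k * (3 * e / 4) ^+ 2 + b * (3 * e / 4) + c) by field.
rewrite r1 r2 r3 mulr0 subr0 addr0 => /eqP; apply/negP.
by rewrite mulf_neq0 // lt0r_neq0 // divr_gt0 // exprn_gt0.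
Qed.

Context (a : R -> R) (T Rr F G : R -> R -> R).
Hypothesis a_gt0 : forall t, 0 < t -> 0 < a t.
Hypothesis a_smooth : smooth_on [set t : R | 0 < t] a.
Hypothesis psi_nat : natural_spherical_change a T Rr F G.
Context (O : 'M[R]_3).
Hypothesis O_orth : O *m O^T = 1%:M.

Local Notation r := (@sph_rad R).
Local Notation w := (axis_coord O).

(** With cos theta = w 2 / r, the equation G = - tan^2 theta becomes cos^2 theta (1 - G) = 1. A
    nonzero [w p 0] keeps [p] off the axis, and a nonzero [w p 2] away from theta = pi / 2. *)
Lemma not_axis_excluded p : 0 < r p -> w p 0 != 0 -> w p 2 != 0 ->
  G (p 0 0) (r p) != 0 ->
  w p 2 ^+ 2 * (1 - G (p 0 0) (r p)) != r p ^+ 2 -> ~ axis_excluded O G p.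
Proof.
move=> rp w0 w2 G0 ne.
have rr : r p ^+ 2 = w p 0 ^+ 2 + w p 1 ^+ 2 + w p 2 ^+ 2.
  by rewrite sph_rad_sqr (dot3_axis O_orth) -!expr2.
have w02 : 0 < w p 0 ^+ 2 by rewrite exprn_even_gt0.
have lt2 : w p 2 ^+ 2 < r p ^+ 2 by have := sqr_ge0 (w p 1); lra.
set x := w p 2 / r p.
have x2 : x ^+ 2 < 1.
  by rewrite /x expr_div_n ltr_pdivrMr ?exprn_gt0 // mul1r.
have x1 : -1 <= x <= 1 by apply/andP; split; nra.
have cosE : cos (theta O p) = x by rewrite /theta acosK.
have sinE : sin (theta O p) ^+ 2 = 1 - x ^+ 2.
  by have := cos2Dsin2 (theta O p); rewrite cosE; lra.
have x0 : x != 0 by rewrite mulf_neq0 // invr_eq0 lt0r_neq0.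
case=> [e|e|e].
- move/eqP: ne; apply.
  have e2 : G (p 0 0) (r p) * x ^+ 2 = x ^+ 2 - 1.
    rewrite e /tan expr_div_n cosE sinE; field.
    by rewrite ?expf_neq0.
  have -> : w p 2 = x * r p by rewrite /x divfK // lt0r_neq0.
  rewrite exprMn; transitivity ((x ^+ 2 - G (p 0 0) (r p) * x ^+ 2) * r p ^+ 2).
    by ring.
  by rewrite e2; ring.
- by move: x2; rewrite -cosE e cos0 expr1n ltxx.
- by move: x2; rewrite -cosE e cospi sqrrN expr1n ltxx.
Qed.

(* For fixed t and r, the excluded values of theta are roots of polynomials. *)
Lemma generic_angle p (N : set 'rV[R]_4) : nbhs p N -> N `<=` flrw_tilde a ->
  open N -> exists q, [/\ N q, w q 2 != 0 & ~ axis_excluded O G q].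
Proof.
move=> Np NM oN.
have wv x y t (k : 'I_3) : w (axis_vec O (row3 x y t)) k = row3 x y t 0 k.
  exact: axis_coord_vec.
have [p1 [Np1 w10 w12]] : exists q, [/\ N q, w q 0 != 0 & w q 2 != 0].
  (* Along [b] both coordinates grow by h, so their product is a monic quadratic in h. *)
  pose b := axis_vec O (row3 1 0 1).
  have /nbhs_ballP[e /= e0 He] := near_line b Np.
  have [h /andP[h0 he] ne] := quadratic_nonroot (w p 0 + w p 2) (w p 0 * w p 2)
    (oner_neq0 R) e0.
  exists (p + h *: b).
  have hw : (w p 0 + h) * (w p 2 + h) != 0.
    by apply: contra ne => /eqP e1; apply/eqP; rewrite -e1; ring.
  move: hw; rewrite mulf_eq0 negb_or => /andP[hw0 hw2].
  rewrite !axis_coordD !axis_coordZ !wv !mxE /= !mulr1; split => //.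
  by apply: He; rewrite -ball_normE /= sub0r normrN gtr0_norm.
have Mp1 := NM _ Np1; have rp := flrw_tilde_sph_rad_gt0 Mp1.
set t0 := p1 0 0; set r1 := r p1 in rp *.
have G0 : G t0 r1 != 0.
  apply: contra_eq_neq (spherical_coef_inv a_gt0 a_smooth psi_nat Mp1) => ->.
  by rewrite mul0r eq_sym oner_neq0.
pose b := axis_vec O (row3 0 0 1); pose e0 : 'rV[R]_4 := delta_mx 0 0.
have e00 : e0 0 0 = 1 by rewrite /e0 mxE.
have b00 : b 0 0 = 0 by exact: axis_vec0.
have wb k : w b k = row3 0 0 1 0 k by exact: wv.
have we0 k : w e0 k = 0.
  rewrite /axis_coord; have -> : spat e0 = 0.
    by apply/rowP => j; rewrite /spat /e0 !mxE.
  by rewrite mul0mx mxE.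
clearbody b e0.
(* [Q h] is the squared radius after a shift by h along the axis, and [m h] rescales to radius [r1].
   Thus [sigma] keeps t and r, hence also the value of G, and changes only the angle. *)
pose Q (h : R) := r1 ^+ 2 + h * (2 * w p1 2 + h).
have rr : r1 ^+ 2 = w p1 0 ^+ 2 + w p1 1 ^+ 2 + w p1 2 ^+ 2.
  by rewrite sph_rad_sqr (dot3_axis O_orth) -!expr2.
have w02 : 0 < w p1 0 ^+ 2 by rewrite exprn_even_gt0.
have Q0 h : 0 < Q h.
  have -> : Q h = w p1 0 ^+ 2 + w p1 1 ^+ 2 + (w p1 2 + h) ^+ 2.
    by rewrite /Q rr; ring.
  by have := sqr_ge0 (w p1 1); have := sqr_ge0 (w p1 2 + h); lra.
pose m h := r1 / Num.sqrt (Q h).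
have sQ h : Num.sqrt (Q h) ^+ 2 = Q h by rewrite sqr_sqrtr // ltW.
have sQ0 h : 0 < Num.sqrt (Q h) by rewrite sqrtr_gt0.
have m0 h : 0 < m h by rewrite divr_gt0.
pose sigma h := t0 *: e0 + m h *: (p1 - t0 *: e0 + h *: b).
have sigma0 h : sigma h 0 0 = t0.
  by rewrite /sigma !mxE b00 e00 -/t0; ring.
have ws h k : w (sigma h) k = m h * (w p1 k + h * row3 0 0 1 0 k).
  rewrite /sigma -scaleNr !(axis_coordD, axis_coordZ) we0 wb.
  by rewrite !mulr0 add0r addr0.
have ws0 h : w (sigma h) 0 = m h * w p1 0 by rewrite ws mxE /= mulr0 addr0.
have ws1 h : w (sigma h) 1 = m h * w p1 1 by rewrite ws mxE /= mulr0 addr0.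
have ws2 h : w (sigma h) 2 = m h * (w p1 2 + h) by rewrite ws mxE /= mulr1.
have mQ h : m h ^+ 2 * Q h = r1 ^+ 2.
  by rewrite /m expr_div_n sQ divfK // lt0r_neq0.
have rs h : r (sigma h) = r1.
  apply/eqP; rewrite -(@eqrXn2 _ 2) ?sph_rad_ge0 ?ltW // sph_rad_sqr.
  rewrite (dot3_axis O_orth) ws0 ws1 ws2 -(mQ h) /Q rr; apply/eqP; ring.
have mc : {for 0, continuous m}.
  have Qc : {for 0, continuous Q}.
    apply: cvgD; first exact: cvg_cst.
    apply: cvgM; first exact: cvg_id.
    by apply: cvgD; [exact: cvg_cst | exact: cvg_id].
  have Sc := cvg_comp _ _ Qc (@sqrt_continuous R (Q 0)).
  by apply: cvgMl_tmp; apply: cvgV Sc; rewrite lt0r_neq0.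
have Q00 : Q 0 = r1 ^+ 2 by rewrite /Q mul0r addr0.
have m00 : m 0 = 1.
  by rewrite /m Q00 sqrtr_sqr gtr0_norm // mulfV // lt0r_neq0.
have s00 : sigma 0 = p1.
  by rewrite /sigma m00 scale1r scale0r addr0 addrC subrK.
have sc : sigma h @[h --> (0 : R)] --> p1.
  rewrite -[X in _ --> X]s00; apply: cvgD; first exact: cvg_cst.
  apply: cvgZ => //; apply: cvgD; first exact: cvg_cst.
  by apply: cvgZr_tmp; exact: cvg_id.
have nN : \forall h \near (0 : R), N (sigma h).
  exact: sc _ (open_nbhs_nbhs (conj oN Np1)).
have /nbhs_ballP[e /= e_gt0 He] := nN.
pose e' := Num.min e `|w p1 2|.
have e'0 : 0 < e' by rewrite lt_min e_gt0 normr_gt0.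
have NG0 : - G t0 r1 != 0 by rewrite oppr_eq0.
(* This quadratic is (w_2 + h)^2 (1 - G) - Q(h), with leading coefficient -G; h below |w_2| keeps
   w_2 + h nonzero. *)
have [h /andP[h0 he] ne] := quadratic_nonroot (- 2 * G t0 r1 * w p1 2)
  (w p1 2 ^+ 2 * (1 - G t0 r1) - r1 ^+ 2) NG0 e'0.
have [he1 he2] : h < e /\ h < `|w p1 2| by move: he; rewrite lt_min => /andP[].
exists (sigma h).
have w2h : w (sigma h) 2 != 0.
  rewrite ws2 mulf_neq0 //; first by rewrite lt0r_neq0.
  apply: contraTneq he2 => e1; rewrite -leNgt.
  have -> : w p1 2 = - h by lra.
  by rewrite normrN ger0_norm // ltW.
split => //; first by apply: He; rewrite -ball_normE /= sub0r normrN gtr0_norm.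
apply: not_axis_excluded; rewrite ?rs ?sigma0 //.
  by rewrite ws0 mulf_neq0 // lt0r_neq0.
apply: contra ne => /eqP e1; apply/eqP.
apply: (mulfI (lt0r_neq0 (exprn_gt0 2 (m0 h)))); rewrite mulr0.
have : m h ^+ 2 * ((w p1 2 + h) ^+ 2 * (1 - G t0 r1) - Q h) = 0.
  by rewrite mulrBr mQ mulrA -exprMn -ws2 e1 subrr.
move=> <-; rewrite /Q; ring.
Qed.

(** If [S] contained the image of a neighbourhood, a chart coordinate of [iota] would vanish
    identically there; but the invertible Jacobian provides a direction in which it has derivative
    1. *)
Lemma avoid_submanifold (E : spacetime R) (M : set 'rV[R]_4)
    (iota : 'rV[R]_4 -> E) (S : set E) q (N : set 'rV[R]_4) :
  smooth_embedding M iota -> submanifold2 S -> N `<=` M -> nbhs q N ->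
  exists2 p, N p & ~ S (iota p).
Proof.
move=> emb sub NM Nq; apply: contrapT => H.
have inS p : N p -> S (iota p).
  by move=> Np; apply: contrapT => nS; apply: H; exists p.
have Nq1 := nbhs_singleton Nq; have Mq := NM _ Nq1.
have [c [ac dc Sc]] := sub _ (inS _ Nq1).
have [_ ic _ sm un] := emb; pose f := to_coord c \o iota.
have fd : differentiable f q by exact: smooth_differentiable (sm c ac) _.
have uJ : 'J f q \in unitmx by exact: un.
have n1 : \forall y \near q, chart_dom c (iota y).
  by apply: ic => //; apply: open_nbhs_nbhs; split => //; exact: open_dom.
have f2 : \forall y \near q, f y 0 2 = 0.
  by apply: filterS2 n1 Nq => y dy /inS /(Sc _ dy)[].
pose v := (delta_mx 0 2 : 'rV[R]_4) *m invmx ('J f q).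
have e1 : ('D_v f q) 0 2 = 1.
  by rewrite (deriveEjacobian v fd) /v mulmxKV // mxE.
have [_ e2] := derive_coord_line v 2 fd.
have e3 : 'D_1 (fun h : R => f (q + h *: v) 0 2) 0 = 'D_1 (cst (0 : R)) (0 : R).
  have f2' := near_line v f2.
  by apply: near_eq_derive; apply: filterS f2' => h eh; exact: eh.
rewrite e2 e1 derive_cst in e3.
by have := oner_neq0 R; rewrite e3 eqxx.
Qed.

End Genericity.

Theorem corollary28 (R : realType) (a : R -> R) (a'0 : \bar R)
    (T Rr F G : R -> R -> R) :
  smooth_on [set t : R | 0 < t] a ->
  (forall t, 0 < t -> 0 < a t) ->
  a t @[t --> 0^'+] --> (0 : R) ->
  (derive1 a t)%:E @[t --> 0^'+] --> a'0 ->
  (0 <= a'0)%E ->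
  a'0 <> 1%E ->
  future_C0_inextendible (@flrw_domain R) (flrw_metric a) (@flrw_future R) ->
  natural_spherical_change a T Rr F G ->
  ~ exists (E : spacetime R) (iota : 'rV[R]_4 -> E),
      natural_axisymmetric_extension a T Rr G iota.
Proof.
move=> a_smooth a_gt0 a_lim a'_lim a'0_ge0 a'0_neq1 inext psi_nat.
move=> [E [iota [ext nat]]]; apply: a'0_neq1.
have no_fb q : ~ future_boundary (@flrw_domain R) iota q.
  by move=> fq; apply: inext; exists E, iota; split => //; exists q.
have [emb _ _ img] := ext.
have oM := @flrw_domain_open R.
have M0 : @flrw_domain R !=set0.
  by exists (delta_mx 0 0); rewrite /flrw_domain /= mxE ltr01.
have [p0 bp0] := embedding_boundary_nonempty oM emb M0 img.
have [V [S [c [[nV SV] subS tildeV [ac dc sax] [Om [z [rho [psi_a_nat _]]]]]]]] :=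
  nat p0 bp0.
set D := _ `\` axis_excluded Om G in psi_a_nat.
have [orthO _ _ _ _] := psi_a_nat.
have oV : open V by case: nV.
have nbV : nbhs p0 V by exact: open_nbhs_nbhs.
have [t1 t10 times] := boundary_times a_gt0 a_smooth ext no_fb bp0 nbV.
have dense s1 s2 : 0 < s1 -> s1 < s2 -> s2 < t1 -> exists t : R,
    s1 < t < s2 /\ \forall x \near t, curv a x = curv a t.
  move=> s10 s12 s2t.
  have [||q [Mq qs Vq]] := times ((s1 + s2) / 2); [lra | lra |].
  (* All perturbations of [q] are kept in this slab, so that the resulting time stays between s1 and
     s2. *)
  pose I := [set p : 'rV[R]_4 | s1 < p 0 0 < s2].
  have oI : open I.
    have -> : I = (fun p : 'rV[R]_4 => p 0 0) @^-1` [set` `]s1, s2[].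
      by apply/seteqP; split => p; rewrite /I /= in_itv.
    apply: open_comp; last exact: interval_open.
    by move=> p _; exact: (@coord_continuous R 1 4 0 0 p).
  have Iq : I q by rewrite /I /= qs; apply/andP; split; lra.
  have n1 : nbhs q ((@flrw_domain R `&` iota @^-1` V) `&` I).
    apply: filterI; last exact: open_nbhs_nbhs.
    by apply: preimage_nbhs => //; exact: open_nbhs_nbhs.
  have [p [[Mp Vp] Ip] nSp] : exists2 p, ((@flrw_domain R `&` iota @^-1` V) `&` I) p
      & ~ S (iota p).
    by apply: avoid_submanifold emb subS _ n1 => y [[]].
  (* [N] is open because [V] minus [S] is the domain of the chart [c]; hence the angle can be
     perturbed without meeting [S] again. *)
  pose N := (@flrw_domain R `&` iota @^-1` (V `\` S)) `&` I.
  have oN : open N.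
    by apply: openI oI; rewrite -dc; exact: chart_preimage_open.
  have Np : N p by [].
  have NM : N `<=` flrw_tilde a by move=> y [[My Vy] _]; exact: tildeV.
  have [p' [Np' w2 nex]] := generic_angle a_gt0 a_smooth psi_nat orthO
    (open_nbhs_nbhs (conj oN Np)) NM oN.
  have Dp' : D p' by case: Np' => [[My Vy] _]; split.
  exists (p' 0 0); split; first by case: Np'.
  exact: (curv_locally_constant a_gt0 a_smooth psi_nat psi_a_nat Dp' w2).
have const := curv_constant a_gt0 a_smooth dense.
apply: (curv_constant_slope a_gt0 (t1 := t1) (k := curv a (t1 / 2)) t10 a_lim a'_lim a'0_ge0).
move=> t t0 tt1; have [tlt|tgt|->//] := ltgtP t (t1 / 2).
- by apply: const => //; lra.
- by apply/esym; apply: const => //; lra.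
Qed.
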